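(* Let $\mathbf i=(I,I_0,\varepsilon,d)$ be a seed and let $i\neq j$ be non-frozen elements of $I$. Let $h=2,3,4,6$ when $p=0,1,2,3$ respectively. If $$\varepsilon_{ij}=-p\,\varepsilon_{ji}=-p,$$ then $(\sigma_{ij}\circ\mu_i)^{h+2}$ is a trivial cluster transformation, i.e. it is a seed cluster transformation $\mathbf i\to\mathbf i$ which induces the identity map both on the seed $\mathcal A$-torus $\mathcal A_{\mathbf i}$ and on the seed $\mathcal X$-torus $\mathcal X_{\mathbf i}$.
   Context: A seed $\mathbf i=(I,I_0,\varepsilon,d)$ consists of a finite set $I$, a subset $I_0\subset I$ of frozen elements, a $\mathbb Q$-valued function $\varepsilon=(\varepsilon_{ij})$ on $I\times I$ with $\varepsilon_{ij}\in\mathbb Z$ unless $i,j$ are both in $I_0$, and positive integers $d=\{d_i\}_{i\in I}$ with greatest common divisor $1$ such that $\widehat\varepsilon_{ij}:=\varepsilon_{ij}d_j^{-1}$ is skew-symmetric. For $k\in I\setminus I_0$ the mutated seed $\mu_k(\mathbf i)=(I,I_0,\varepsilon',d)$ is given by $\varepsilon'_{ij}=-\varepsilon_{ij}$ if $k\in\{i,j\}$; $\varepsilon'_{ij}=\varepsilon_{ij}$ if $k\notin\{i,j\}$ and $\varepsilon_{ik}\varepsilon_{kj}\le 0$; $\varepsilon'_{ij}=\varepsilon_{ij}+|\varepsilon_{ik}|\varepsilon_{kj}$ if $k\notin\{i,j\}$ and $\varepsilon_{ik}\varepsilon_{kj}>0$. The seed $\mathcal X$-torus $\mathcal X_{\mathbf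 i}$ (resp. seed $\mathcal A$-torus $\mathcal A_{\mathbf i}$) is the split algebraic torus with coordinates $\{X_i\}_{i\in I}$ (resp. $\{A_i\}_{i\in I}$). The mutation induces birational maps $\mathcal X_{\mathbf i}\to\mathcal X_{\mu_k(\mathbf i)}$, $\mathcal A_{\mathbf i}\to\mathcal A_{\mu_k(\mathbf i)}$, also denoted $\mu_k$: with $X'_i,A'_i$ the coordinates for $\mu_k(\mathbf i)$, $$\mu_k^*X'_k=X_k^{-1},\qquad \mu_k^*X'_i=X_i(1+X_k^{-\mathrm{sgn}(\varepsilon_{ik})})^{-\varepsilon_{ik}}\ (i\ne k),$$ $$A_k\cdot\mu_k^*A'_k=\prod_{j:\varepsilon_{kj}>0}A_j^{\varepsilon_{kj}}+\prod_{j:\varepsilon_{kj}<0}A_j^{-\varepsilon_{kj}},\qquad \mu_k^*A'_i=A_i\ (i\neq k),$$ where an empty product is $1$. A seed isomorphism $\sigma$ is a bijection of index sets preserving frozen elements, $\varepsilon$ and $d$; it induces isomorphisms of tori by $\sigma^*X'_{\sigma(i)}=X_i$, $\sigma^*A'_{\sigma(i)}=A_i$. For $i\ne j$, $\sigma_{ij}(\mathbf i)$ denotes the seed obtained by transporting the structure along the transposition of $I$ interchanging $i$ and $j$; $\sigma_{ij}$ also denotes the corresponding seed isomorphism. A seed cluster transformation is a composition of mutations and seed isomorphisms. In $(\sigma_{ij}\circ\mu_i)^{h+2}$ each factor mutates the current seed at its vertex labelled $i$ and then interchanges the labels $i$ and $j$. *)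

(* Defs.v *)
From HB Require Import structures.
From mathcomp Require Export all_boot all_order all_algebra.
From mathcomp Require Export perm fraction mpoly.
From mathcomp Require Import ring.

Set Implicit Arguments.
Unset Strict Implicit.
Unset Printing Implicit Defensive.

Import Order.TTheory GRing.Theory Num.Theory.

Local Open Scope ring_scope.

Section SeedAxioms.
Variables (I : finType) (I0 : {set I}).
Variables (e : {ffun I -> {ffun I -> rat}}) (d : {ffun I -> nat}).

Definition eps_integral :=
  [forall i, forall j, ~~ ((i \in I0) && (j \in I0)) ==> (e i j \is a Num.int)].

Definition mult_pos := [forall i, (0 < d i)%N].

Definition mult_coprime := \big[gcdn/0%N]_i d i == 1%N.

Definition eps_hat i j : rat := e i j / (d j)%:R.

Definition eps_skew := [forall i, forall j, eps_hat i j == - eps_hat j i].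

Definition seed_axioms :=
  [&& eps_integral, mult_pos, mult_coprime & eps_skew].

End SeedAxioms.

Record seed (I : finType) := Seed {
  frozen : {set I};
  eps : {ffun I -> {ffun I -> rat}};
  mult : {ffun I -> nat};
  seedP : seed_axioms frozen eps mult
}.

Section Mutation.
Variables (I : finType) (s : seed I) (k : I).

Definition mut_eps : {ffun I -> {ffun I -> rat}} :=
  [ffun i => [ffun j =>
    if (k == i) || (k == j) then - eps s i j
    else if eps s i k * eps s k j <= 0 then eps s i j
    else eps s i j + `|eps s i k| * eps s k j]].

Lemma mut_axioms : k \notin frozen s -> seed_axioms (frozen s) mut_eps (mult s).
Proof.
move=> hk; have /and4P[hint hpos hgcd hskew] := seedP s.
have int_eps i j : ~~ ((i \in frozen s) && (j \in frozen s)) ->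
  eps s i j \is a Num.int.
  by move=> hij; have /forallP/(_ i)/forallP/(_ j)/implyP := hint; apply.
have int_l i : eps s i k \is a Num.int by rewrite int_eps // (negPf hk) andbF.
have int_r i : eps s k i \is a Num.int by rewrite int_eps // (negPf hk).
apply/and4P; split=> //.
  apply/forallP => i; apply/forallP => j; apply/implyP => /int_eps hij.
  rewrite !ffunE; case: ifP => _; first by rewrite rpredN.
  case: ifP => _ //; apply: rpredD => //; apply: rpredM => //.
  by rewrite normrEsign rpredM // rpredX // rpredN rpred1.
have mult_gt0 i : 0 < (mult s i)%:R :> rat.
  by rewrite ltr0n; move/forallP: hpos.
have mult_neq0 i : (mult s i)%:R != 0 :> rat by rewrite gt_eqF.
have skew i j : eps s i j = - (eps s j i * ((mult s j)%:R / (mult s i)%:R)).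
  have /forallP/(_ i)/forallP/(_ j)/eqP := hskew.
  rewrite /eps_hat => /(congr1 ( *%R^~ (mult s j)%:R)).
  by rewrite divfK // => ->; rewrite mulNr mulrAC mulrA.
apply/forallP => i; apply/forallP => j.
have /forallP/(_ i)/forallP/(_ j)/eqP := hskew.
rewrite /eps_hat !ffunE orbC => heps.
case: ifP => _; first by rewrite !mulNr heps.
have -> : (eps s j k * eps s k i <= 0) = (eps s i k * eps s k j <= 0).
  rewrite (skew j k) (skew k i) mulrNN mulrACA.
  by rewrite pmulr_lle0 1?mulrC // mulr_gt0 ?divr_gt0.
case: ifP => [_|/negbT]; first by rewrite heps.
rewrite -ltNge => hgt0; rewrite !mulrDl heps opprD; apply/eqP; congr (_ + _).
rewrite (skew j k) (skew k i) normrN normrM.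
rewrite (ger0_norm (x := _ / _)); last by rewrite ltW // divr_gt0.
have -> : `|eps s i k| * eps s k j = `|eps s k j| * eps s i k.
  move: hgt0; case: (ltrgt0P (eps s i k)) => hik.
  - by rewrite pmulr_rgt0 // => hkj; rewrite gtr0_norm // mulrC.
  - by rewrite nmulr_rgt0 // => hkj; rewrite ltr0_norm // mulNr mulrC -mulNr.
  - by rewrite hik mul0r ltxx.
by field; rewrite ?mult_neq0.
Qed.

Definition mutation (hk : k \notin frozen s) : seed I := Seed (mut_axioms hk).

End Mutation.


Section Transport.
Variables (I : finType) (s : seed I) (p : {perm I}).

Definition tr_frozen := [set p i | i in frozen s].

Definition tr_eps : {ffun I -> {ffun I -> rat}} :=
  [ffun i => [ffun j => eps s (p^-1%g i) (p^-1%g j)]].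

Definition tr_mult : {ffun I -> nat} := [ffun i => mult s (p^-1%g i)].

Lemma mem_tr_frozen i : (i \in tr_frozen) = (p^-1%g i \in frozen s).
Proof. by rewrite -{1}(permKV p i) mem_imset //; apply: perm_inj. Qed.

Lemma tr_axioms : seed_axioms tr_frozen tr_eps tr_mult.
Proof.
have /and4P[/forallP hint /forallP hpos /eqP hgcd /forallP hskew] := seedP s.
apply/and4P; split.
- apply/forallP => i; apply/forallP => j; rewrite !ffunE !mem_tr_frozen.
  exact: (forallP (hint _)).
- by apply/forallP => i; rewrite ffunE.
- rewrite /mult_coprime -hgcd [X in _ == X](reindex_inj (@perm_inj _ p^-1%g)).
  by apply/eqP; apply: eq_bigr => i _; rewrite ffunE.
- apply/forallP => i; apply/forallP => j; rewrite /eps_hat !ffunE.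
  exact: (forallP (hskew _)).
Qed.

Definition transport : seed I := Seed tr_axioms.

End Transport.

Record seed_iso (I J : finType) (s : seed I) (t : seed J) := SeedIso {
  iso_fun : I -> J;
  iso_inv : J -> I;
  iso_funK : cancel iso_fun iso_inv;
  iso_invK : cancel iso_inv iso_fun;
  iso_frozen : forall i, (iso_fun i \in frozen t) = (i \in frozen s);
  iso_eps : forall i j, eps t (iso_fun i) (iso_fun j) = eps s i j;
  iso_mult : forall i, mult t (iso_fun i) = mult s i
}.

Section TransportIso.
Variables (I : finType) (s : seed I) (p : {perm I}).

Lemma tr_frozenE i : (p i \in frozen (transport s p)) = (i \in frozen s).
Proof. by rewrite mem_tr_frozen permK. Qed.

Lemma tr_epsE i j : eps (transport s p) (p i) (p j) = eps s i j.
Proof. by rewrite !ffunE !permK. Qed.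

Lemma tr_multE i : mult (transport s p) (p i) = mult s i.
Proof. by rewrite ffunE permK. Qed.

Definition transport_iso : seed_iso s (transport s p) :=
  SeedIso (permK p) (permKV p) tr_frozenE tr_epsE tr_multE.

End TransportIso.

Inductive cluster_transf : forall I J : finType, seed I -> seed J -> Type :=
| CTid (I : finType) (s : seed I) : cluster_transf s s
| CTmut (I : finType) (s : seed I) (k : I) (hk : k \notin frozen s) :
    cluster_transf s (mutation hk)
| CTiso (I J : finType) (s : seed I) (t : seed J) (f : seed_iso s t) :
    cluster_transf s t
| CTcomp (I J L : finType) (s : seed I) (t : seed J) (u : seed L) :
    cluster_transf t u -> cluster_transf s t -> cluster_transf s u.

Section FunctionField.
Variable K : fieldType.

(* The function field K(x_i, i in I) of the split torus with coordinates
   indexed by I; the variable x_i is 'X_(enum_rank i). *)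
Definition funfield (I : finType) := {fraction {mpoly K[#|I|]}}.

Definition coord (I : finType) (i : I) : funfield I :=
  FracField.tofrac 'X_(enum_rank i).

Section Pullback.
Variables (I J : finType) (f : J -> funfield I).

Definition poly_pullback (P : {mpoly K[#|J|]}) : funfield I :=
  mmap (fun c => FracField.tofrac c%:MP) (fun m => f (enum_val m)) P.

(* The comorphism of the rational map from the I-torus to the J-torus with
   components f: substitution of f j for x_j in a representing fraction.
   When the f j are algebraically independent over K (as for the birational
   maps below) no denominator vanishes, so that this is the unique K-embedding
   of fields sending each x_j to f j. *)
Definition pullback (u : funfield J) : funfield I :=
  let r := generic_quotient.repr u in poly_pullback \n_r / poly_pullback \d_r.

End Pullback.

Section MutationMaps.
Variables (I : finType) (s : seed I) (k : I).

Let x := @coord I.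

(* The exponents are entries of eps with a nonfrozen index k, so they are
   integers and numq is their value. *)
Definition mutX (i : I) : funfield I :=
  if i == k then (x k)^-1
  else x i * (1 + x k ^ (- sgz (eps s i k))) ^ (- numq (eps s i k)).

Definition mutA (i : I) : funfield I :=
  if i == k then
    (\prod_(j | 0 < eps s k j) x j ^ numq (eps s k j)
      + \prod_(j | eps s k j < 0) x j ^ (- numq (eps s k j))) / x k
  else x i.

End MutationMaps.

Definition isoM (I J : finType) (s : seed I) (t : seed J) (f : seed_iso s t)
  (j : J) : funfield I := coord (iso_inv f j).

Fixpoint pullX (I J : finType) (s : seed I) (t : seed J)
    (T : cluster_transf s t) : funfield J -> funfield I :=
  match T in @cluster_transf I J _ _ return funfield J -> funfield I with
  | CTid _ _ => id
  | @CTmut _ s k _ => pullback (mutX s k)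
  | CTiso _ _ _ _ f => pullback (isoM f)
  | CTcomp _ _ _ _ _ _ T2 T1 => pullX T1 \o pullX T2
  end.

Fixpoint pullA (I J : finType) (s : seed I) (t : seed J)
    (T : cluster_transf s t) : funfield J -> funfield I :=
  match T in @cluster_transf I J _ _ return funfield J -> funfield I with
  | CTid _ _ => id
  | @CTmut _ s k _ => pullback (mutA s k)
  | CTiso _ _ _ _ f => pullback (isoM f)
  | CTcomp _ _ _ _ _ _ T2 T1 => pullA T1 \o pullA T2
  end.

Definition trivial_transf (I : finType) (s t : seed I)
    (T : cluster_transf s t) : Prop :=
  [/\ t = s, pullA T =1 id & pullX T =1 id].

End FunctionField.

Section SigmaMu.
Variables (I : finType) (i j : I).

Section Step.
Variables (s : seed I) (hi : i \notin frozen s) (hj : j \notin frozen s).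

Definition sigma_mu_seed : seed I := transport (mutation hi) (tperm i j).

Definition sigma_mu : cluster_transf s sigma_mu_seed :=
  CTcomp (CTiso (transport_iso (mutation hi) (tperm i j))) (CTmut hi).

Lemma sigma_mu_i : i \notin frozen sigma_mu_seed.
Proof. by rewrite mem_tr_frozen tpermV tpermL. Qed.

Lemma sigma_mu_j : j \notin frozen sigma_mu_seed.
Proof. by rewrite mem_tr_frozen tpermV tpermR. Qed.

End Step.

Fixpoint sigma_mu_iter_seed (n : nat) (s : seed I)
    (hi : i \notin frozen s) (hj : j \notin frozen s) : seed I :=
  if n is m.+1 then sigma_mu_iter_seed m (sigma_mu_i hi hj) (sigma_mu_j hi)
  else s.

Fixpoint sigma_mu_iter (n : nat) (s : seed I)
    (hi : i \notin frozen s) (hj : j \notin frozen s) :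
    cluster_transf s (sigma_mu_iter_seed n hi hj) :=
  if n is m.+1 then
    CTcomp (sigma_mu_iter m (sigma_mu_i hi hj) (sigma_mu_j hi)) (sigma_mu hi)
  else CTid s.

End SigmaMu.

(* Main.v *)
From HB Require Import structures.
Require Import Defs.
From mathcomp Require Import fingroup.
From mathcomp Require Import ring lra zify.
Set Implicit Arguments.
Unset Strict Implicit.
Unset Printing Implicit Defensive.
Import Order.TTheory GRing.Theory Num.Theory.
Local Open Scope ring_scope.

(** A step [sigma_ij o mu_i] turns the mutation dynamics into second order
    recurrences in the number [m] of steps.  Put [r_m = - eps_ij] after [m]
    steps; then [eps_ji = r_(m+1)] and [r_(m+2) = r_m], so [r] alternates
    between [p] and [1] (or is [0] if [p = 0]): these are the rank 2 root
    systems A1 x A1, A2, B2, G2, whose Coxeter number is [h].  With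
    [x = pospart x - negpart x], three kinds of data evolve.

    - The column entry [c_m = eps_li] at a vertex [l] other than [i], [j]
      satisfies [c_(m+2) = - c_m - r_(m+1) negpart c_(m+1)], and row entries
      satisfy the mirror recurrence.  Both have period [h + 2]
      (tropical_period), and the increments of the remaining entries telescope
      to zero over a period (entry_return).  Hence the seed returns.

    - With [z_m] the inverse of the [m]-th value of [X_i], one gets the
      Y-system [z_(m+2) z_m = (1 + z_(m+1))^(r_m)], of period [h + 2] because
      its solutions are explicit Laurent fractions in [z_0], [z_1]
      (Ysystem_period).  At step [m] every other [X_l] is multiplied by
      [(1 + z_m)^(- c_m) z_m^(- negpart c_m)].  If all [r_m] are [1], then
      [1 + z_m = z_(m+1) z_(m-1)], and the tropical recurrence says precisely
      that the exponent of each [z_m] in the product over a period vanishes.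
      For [p = 2, 3] half of the [1 + z_m] are only [p]-th roots of such
      products, so this argument determines the total factor up to a [p]-th
      root of unity; one more identity between the [1 + z_m], provided by
      Ysystem_B2 and Ysystem_G2, removes the ambiguity (Xmonodromy).

    - The values [a_m] of [A_i] satisfy an exchange relation
      [a_(m+2) a_m = M_m + N_m a_(m+1)^(r_m)] with monomials [M_m], [N_m] in
      the other variables.  Its terms have a ratio that solves the same
      Y-system (exchange_Ysystem), which gives the period of [a] up to [p]-th
      roots, and the same extra identities conclude (exchange_return).

    Finally [pullback] substitutes into a chosen representative of a fraction,
    and is a field embedding only if no denominator is killed.  This holds as
    soon as the substituted family [f] admits a family [g] at which each [f_j]
    is regular with value the coordinate [x_j] (pullback_embedding); mutations
    have such inverses.  The pullback of the whole transformation is then a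
    [K]-embedding that fixes the coordinates, hence the identity. *)

(** * Tropical recurrences of finite type *)
Definition pospart (x : int) := Num.max x 0.
Definition negpart (x : int) := Num.max (- x) 0.

(** The pairs of exponents are the off-diagonal entries, up to sign, of the
    rank 2 Cartan matrices of finite type, each with [n] two more than the
    Coxeter number.  Both orders of a pair are listed because a shift by one
    step exchanges the two entries. *)
Definition rank2_exchange (b : nat -> nat) (n : nat) :=
  (forall m, b m.+2 = b m) /\
  ((b 0%N, b 1%N, n) \in [:: (0, 0, 4); (1, 1, 5); (1, 2, 6); (2, 1, 6);
                         (1, 3, 8); (3, 1, 8)])%N.

Lemma rank2_exchange_shift b n k :
  rank2_exchange b n -> rank2_exchange (fun m => b (m + k)%N) n.
Proof.
move=> [b2 b01n]; elim: k => [|k [b2k IHk]].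
  by split=> [m|]; rewrite !addn0.
split=> [m|]; rewrite !(addSn, addnS, add0n, b2) //.
move: IHk; rewrite !(addSn, add0n) !inE !xpair_eqE.
by case: (b k) => [|[|[|[|?]]]]; case: (b k.+1) => [|[|[|[|?]]]];
  rewrite //= ?andbT ?andbF ?orbF.
Qed.

Lemma rank2_exchangeP b n : rank2_exchange b n ->
  exists p q, [/\ forall m, b m = if odd m then q else p &
    (p, q, n) \in [:: (0, 0, 4); (1, 1, 5); (1, 2, 6); (2, 1, 6);
                      (1, 3, 8); (3, 1, 8)]]%N.
Proof.
case=> b2 b01; exists (b 0%N), (b 1%N); split=> // m.
suff [//] : b m = (if odd m then b 1%N else b 0%N) /\
            b m.+1 = (if odd m.+1 then b 1%N else b 0%N).
by elim: m => [|m [IH1 IH2]] //; split=> //; rewrite b2 IH1 /= negbK.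
Qed.

Variant negpart_spec (x : int) : int -> Type :=
  | NegpartNonneg of 0 <= x : negpart_spec x 0
  | NegpartNonpos of x <= 0 : negpart_spec x (- x).

Lemma negpartP x : negpart_spec x (negpart x).
Proof.
rewrite /negpart; case: (leP 0 x) => x0.
  by rewrite max_r ?oppr_le0 //; constructor.
by rewrite max_l ?oppr_ge0 ?ltW //; constructor; apply: ltW.
Qed.

(** The recurrence is piecewise linear, so its return after [n] steps is a
    finite check over the sign patterns of the successive terms; inconsistent
    patterns are discarded as soon as they appear. *)
Lemma tropical_return b n (c : nat -> int) : rank2_exchange b n ->
  (forall m, c m.+2 = - c m - (b m.+1)%:R * negpart (c m.+1)) -> c n = c 0%N.
Proof.
move=> /rank2_exchangeP[p [q [bE]]] pqn cE.
have {}cE m : c m.+2 = - c m - (if odd m then p else q)%:R * negpart (c m.+1).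
  by rewrite cE bE /=; case: (odd m).
move: pqn; rewrite !inE => /or4P[| | |/or3P[| |]] /eqP[pE qE ->];
  rewrite {}pE {}qE in cE.
- by have := cE 0%N; have := cE 2%N; rewrite /= !mul0r; lia.
- have := (cE 0%N, cE 1%N, cE 2%N, cE 3%N).
  move=> -[[[+ +] +] +]; rewrite /= ?mul1r.
  by do 4 (case: negpartP => ? ?; try lia).
- have := (cE 0%N, cE 1%N, cE 2%N, cE 3%N, cE 4%N).
  move=> -[[[[+ +] +] +] +]; rewrite /= ?mul1r.
  by do 5 (case: negpartP => ? ?; try lia).
- have := (cE 0%N, cE 1%N, cE 2%N, cE 3%N, cE 4%N).
  move=> -[[[[+ +] +] +] +]; rewrite /= ?mul1r.
  by do 5 (case: negpartP => ? ?; try lia).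
- have := (cE 0%N, cE 1%N, cE 2%N, cE 3%N, cE 4%N, cE 5%N, cE 6%N).
  move=> -[[[[[[+ +] +] +] +] +] +]; rewrite /= ?mul1r.
  by do 7 (case: negpartP => ? ?; try lia).
- have := (cE 0%N, cE 1%N, cE 2%N, cE 3%N, cE 4%N, cE 5%N, cE 6%N).
  move=> -[[[[[[+ +] +] +] +] +] +]; rewrite /= ?mul1r.
  by do 7 (case: negpartP => ? ?; try lia).
Qed.

Lemma tropical_period b n (c : nat -> int) : rank2_exchange b n ->
  (forall m, c m.+2 = - c m - (b m.+1)%:R * negpart (c m.+1)) ->
  forall m, c (m + n)%N = c m.
Proof.
move=> bn cE m; rewrite addnC.
have ret := tropical_return (rank2_exchange_shift m bn).
by apply: (ret (fun k => c (k + m)%N)) => k; rewrite !addSn cE.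
Qed.

Lemma tropical_period_pospart b n (u : nat -> int) : rank2_exchange b n ->
  (forall m, u m.+2 = - u m + (b m)%:R * pospart (u m.+1)) ->
  forall m, u (m + n)%N = u m.
Proof.
move=> bn uE m; have [b2 _] := bn; apply: oppr_inj.
apply: (@tropical_period _ _ (fun k => - u k) (rank2_exchange_shift 1 bn)) => k.
by rewrite addn1 b2 uE /negpart /pospart; lia.
Qed.

(** * Y-systems of rank 2 *)
Section YSystem.
Variables (F : fieldType) (b : nat -> nat).

(** The conditions [z m != 0] and [1 + z m != 0] hold for images of coordinates
    under field embeddings; here they guarantee that the recurrence determines
    the sequence and that integer powers of both quantities are invertible. *)
Definition Ysystem (z : nat -> F) :=
  [/\ forall m, z m != 0, forall m, 1 + z m != 0
    & forall m, z m.+2 * z m = (1 + z m.+1) ^+ b m].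

Variable z : nat -> F.
Hypothesis zY : Ysystem z.

Let next m x : x * z m = (1 + z m.+1) ^+ b m -> z m.+2 = x.
Proof. by case: zY => nz _ zE xE; apply: (mulIf (nz m)); rewrite zE. Qed.

Let nz m : z m != 0. Proof. by case: zY. Qed.

Lemma Ysystem_A1A1 : (forall m, b m = 0%N) -> forall m, z m.+2 = (z m)^-1.
Proof. by move=> b0 m; apply: next; rewrite b0 expr0 mulVf. Qed.

(** The Laurent phenomenon makes each term a polynomial in [z 0], [z 1] divided
    by a monomial, so that only these two values have to be invertible in order
    to verify the next term.  The same holds in the next two lemmas. *)
Lemma Ysystem_A2 : (forall m, b m = 1%N) -> z 5%N = z 0%N.
Proof.
move=> b1; have [x0 y0] := (nz 0%N, nz 1%N).
have z2 : z 2%N = (1 + z 1%N) / z 0%N by apply: next; rewrite b1; field.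
have z3 : z 3%N = (1 + z 0%N + z 1%N) / (z 0%N * z 1%N).
  by apply: next; rewrite b1 z2; field; rewrite ?x0 ?y0.
have z4 : z 4%N = (1 + z 0%N) / z 1%N.
  by apply: next; rewrite b1 z2 z3; field; rewrite ?x0 ?y0.
by apply: next; rewrite b1 z3 z4; field; rewrite ?x0 ?y0.
Qed.

(** In terms of suitable square roots of the [z k] with [k] even, both sides of
    the last identity are the same monomial; the monomial relations contained in
    the recurrence give only the equality of their squares. *)
Lemma Ysystem_B2 : (forall m, b m = if odd m then 1 else 2)%N ->
  [/\ z 6%N = z 0%N, z 7%N = z 1%N
    & z 0%N * (1 + z 3%N) = (1 + z 1%N) * (1 + z 5%N)].
Proof.
move=> bE; have [x0 y0] := (nz 0%N, nz 1%N).
have z2 : z 2%N = (1 + z 1%N) ^+ 2 / z 0%N by apply: next; rewrite bE /=; field.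
have z3 : z 3%N = (z 0%N + (1 + z 1%N) ^+ 2) / (z 0%N * z 1%N).
  by apply: next; rewrite bE z2 /=; field; rewrite ?x0 ?y0.
have z4 : z 4%N = (1 + z 0%N + z 1%N) ^+ 2 / (z 0%N * z 1%N ^+ 2).
  by apply: next; rewrite bE z2 z3 /=; field; rewrite ?x0 ?y0.
have z5 : z 5%N = (1 + z 0%N) / z 1%N.
  by apply: next; rewrite bE z3 z4 /=; field; rewrite ?x0 ?y0.
have z6 : z 6%N = z 0%N.
  by apply: next; rewrite bE z4 z5 /=; field; rewrite ?x0 ?y0.
split=> //; last by rewrite z3 z5; field; rewrite ?x0 ?y0.
by apply: next; rewrite bE z5 z6 /=; field.
Qed.

(** As in type B2, the last identity compares two expressions of which the
    monomial relations in the recurrence equate only the cubes. *)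
Lemma Ysystem_G2 : (forall m, b m = if odd m then 1 else 3)%N ->
  [/\ z 8%N = z 0%N, z 9%N = z 1%N
    & (1 + z 1%N) * (1 + z 5%N) = (1 + z 3%N) * (1 + z 7%N)].
Proof.
move=> bE; have [x0 y0] := (nz 0%N, nz 1%N).
have z2 : z 2%N = (1 + z 1%N) ^+ 3 / z 0%N by apply: next; rewrite bE /=; field.
have z3 : z 3%N = (z 0%N + (1 + z 1%N) ^+ 3) / (z 0%N * z 1%N).
  by apply: next; rewrite bE z2 /=; field; rewrite ?x0 ?y0.
have z4 : z 4%N = (z 0%N + (1 + z 1%N) ^+ 2) ^+ 3 / (z 0%N ^+ 2 * z 1%N ^+ 3).
  by apply: next; rewrite bE z2 z3 /=; field; rewrite ?x0 ?y0.
have z5 : z 5%N = ((1 + z 0%N) ^+ 2 + (1 + z 0%N) * z 1%N *+ 3 + z 1%N ^+ 2 *+ 3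
                  + z 1%N ^+ 3) / (z 0%N * z 1%N ^+ 2).
  by apply: next; rewrite bE z3 z4 /=; field; rewrite ?x0 ?y0.
have z6 : z 6%N = (1 + z 0%N + z 1%N) ^+ 3 / (z 0%N * z 1%N ^+ 3).
  by apply: next; rewrite bE z4 z5 /=; field; rewrite ?x0 ?y0.
have z7 : z 7%N = (1 + z 0%N) / z 1%N.
  by apply: next; rewrite bE z5 z6 /=; field; rewrite ?x0 ?y0.
have z8 : z 8%N = z 0%N.
  by apply: next; rewrite bE z6 z7 /=; field; rewrite ?x0 ?y0.
split=> //; last by rewrite z3 z5 z7; field; rewrite ?x0 ?y0.
by apply: next; rewrite bE z7 z8 /=; field.
Qed.

End YSystem.

Section YPeriodicity.
Variables (F : fieldType).

Lemma Ysystem_shift b (z : nat -> F) k :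
  Ysystem b z -> Ysystem (fun m => b (m + k)%N) (fun m => z (m + k)%N).
Proof. by move=> [nz nz1 zE]; split=> m //; rewrite !addSn. Qed.

(** This reduces the weights [(1, p)] to [(p, 1)], the case solved explicitly
    above, applied to the sequence without its first term. *)
Lemma Ysystem_return_prev b n (z : nat -> F) : Ysystem b z -> b n = b 0%N ->
  z n.+1 = z 1%N -> z n.+2 = z 2%N -> z n = z 0%N.
Proof.
move=> [nz _ zE] bn z1 z2; apply: (mulfI (nz 2%N)).
by rewrite -{1}z2 !zE z1 bn.
Qed.

Lemma Ysystem_return b n (z : nat -> F) :
  rank2_exchange b n -> Ysystem b z -> z n = z 0%N.
Proof.
move=> /rank2_exchangeP[p [q [bE pqn]]] zY.
have zY1 := Ysystem_shift 1 zY.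
move: pqn; rewrite !inE => /or4P[| | |/or3P[| |]] /eqP[pE qE ->];
  rewrite {}pE {}qE in bE.
- by rewrite !(Ysystem_A1A1 zY) ?invrK // => m; rewrite bE if_same.
- by apply: (Ysystem_A2 zY) => m; rewrite bE if_same.
- have [m|z7 z8 _] := Ysystem_B2 zY1; first by rewrite bE addn1 /=; case: odd.
  by apply: (Ysystem_return_prev zY); rewrite ?bE.
- by have [] := Ysystem_B2 zY bE.
- have [m|z7 z8 _] := Ysystem_G2 zY1; first by rewrite bE addn1 /=; case: odd.
  by apply: (Ysystem_return_prev zY); rewrite ?bE.
- by have [] := Ysystem_G2 zY bE.
Qed.

Lemma Ysystem_period b n (z : nat -> F) :
  rank2_exchange b n -> Ysystem b z -> forall m, z (m + n)%N = z m.
Proof.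
move=> bn zY m; rewrite addnC.
exact: (Ysystem_return (rank2_exchange_shift m bn) (Ysystem_shift m zY)).
Qed.

End YPeriodicity.

(** * Monodromy of the X-coordinates *)

(** The factor by which a mutation multiplies the coordinate of a vertex whose
    column entry is [c m], when [z m] is the inverse of the mutated coordinate:
    the two signs of the mutation formula in one expression. *)
Definition Xfactor (F : fieldType) (z : nat -> F) (c : nat -> int) m :=
  (1 + z m) ^ (- c m) * z m ^ (- negpart (c m)).

Section Monodromy.
Variables (F : fieldType) (b : nat -> nat) (n : nat) (z : nat -> F).
Variable c : nat -> int.
Hypothesis bn : rank2_exchange b n.
Hypothesis zY : Ysystem b z.
Hypothesis cE : forall m, c m.+2 = - c m - (b m.+1)%:R * negpart (c m.+1).

Let nz m : z m != 0. Proof. by case: zY. Qed.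
Let nz1 m : 1 + z m != 0. Proof. by case: zY. Qed.
Let zE m : z m.+2 * z m = (1 + z m.+1) ^+ b m. Proof. by case: zY. Qed.

(** Every [1 + z m] is a product of two neighbours, so each power in the product
    becomes a monomial in the [z m], with exponents that cancel by the tropical
    recurrence. *)
Lemma Xmonodromy_A2 : (forall m, b m = 1%N) -> n = 5%N ->
  \prod_(m < 5) Xfactor z c m = 1.
Proof.
move=> b1 n5.
have z5 := Ysystem_period bn zY 0; have z6 := Ysystem_period bn zY 1.
have c5 := tropical_period bn cE 0; have c6 := tropical_period bn cE 1.
rewrite n5 /= in z5 z6 c5 c6.
have W m : 1 + z m.+1 = z m.+2 * z m by rewrite zE b1.
have t m : - negpart (c m.+1) = c m.+2 + c m by rewrite cE b1; lia.
rewrite !big_ord_recl big_ord0 /Xfactor /= /bump /=.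
have W0 := W 4%N; have t0 := t 4%N; rewrite z5 z6 in W0; rewrite c5 c6 in t0.
rewrite W0 t0 !W !t z5 c5 !expfzDr // !expfzMl -!invr_expz.
by field; rewrite !expfz_neq0.
Qed.

(** Two steps invert [z] and change the sign of [c]: this inverts the factor. *)
Lemma Xmonodromy_A1A1 : (forall m, b m = 0%N) -> n = 4%N ->
  \prod_(m < 4) Xfactor z c m = 1.
Proof.
move=> b0 n4; have zz := Ysystem_A1A1 zY b0.
have cc m : c m.+2 = - c m by rewrite cE b0 mul0r subr0.
have pair m : Xfactor z c m * Xfactor z c m.+2 = 1.
  rewrite /Xfactor zz cc.
  have -> : 1 + (z m)^-1 = (1 + z m) * z m ^ (- 1).
    by rewrite mulrDl mul1r -exprN1 mulfV // addrC.
  have -> : - negpart (- c m) = - negpart (c m) - c m.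
    by rewrite /negpart; lia.
  rewrite opprK -exprN1 expfzMl !exprz_exp !mulN1r !opprD !opprK !expfzDr //.
  by rewrite -!invr_expz; field; rewrite !expfz_neq0.
rewrite !big_ord_recl big_ord0 /= /bump /= mulr1 mulrA mulrACA.
by rewrite !pair mulr1.
Qed.

(** For odd [m], the recurrence writes [1 + z m.+1] as [z m.+2 * z m], and the
    factors involving these cancel as in type A2.  For the others, the extra
    identity expresses each even-indexed [z k] through the odd-indexed
    [1 + z m], and the three odd-indexed [c m] are integer combinations of the
    [negpart (c k)] with [k] even. *)
Lemma Xmonodromy_B2 : (forall m, b m = if odd m then 1 else 2)%N -> n = 6%N ->
  \prod_(m < 6) Xfactor z c m = 1.
Proof.
move=> bE n6; have := tropical_period bn cE; have := Ysystem_period bn zY.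
rewrite n6 => zP cP.
have [z6 z7] := (zP 0%N, zP 1%N); have [c6 c7] := (cP 0%N, cP 1%N).
rewrite /= in z6 z7 c6 c7.
(* The extra identity, rotated by the even amount [k]. *)
have Rz k : ~~ odd k ->
    z k = (1 + z (1 + k)%N) * (1 + z (5 + k)%N) / (1 + z (3 + k)%N).
  move=> k_even; have [|_ _ <-] := Ysystem_B2 (Ysystem_shift k zY).
    by move=> m; rewrite bE oddD (negPf k_even) addbF.
  by rewrite add0n mulfK.
have b_odd m : odd m -> b m = 1%N by rewrite bE => ->.
have b_even m : ~~ odd m -> b m = 2%N by rewrite bE => /negPf ->.
have W m : odd m -> 1 + z m.+1 = z m.+2 * z m by move=> om; rewrite zE bE om.
have t m : ~~ odd m -> - negpart (c m.+1) = c m.+2 + c m.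
  by move=> em; rewrite cE b_odd ?oddS //; lia.
have t' m : odd m -> negpart (c m.+1) + negpart (c m.+1) = - (c m.+2 + c m).
  by move=> om; rewrite cE b_even ?oddS ?negbK //; lia.
have := (t' 1%N isT, t' 3%N isT, t' 5%N isT); rewrite c6 c7.
have := (t 0%N isT, t 2%N isT, t 4%N isT); rewrite c6.
have := (W 1%N isT, W 3%N isT, W 5%N isT); rewrite z6 z7.
have := (Rz 0%N isT, Rz 2%N isT, Rz 4%N isT); rewrite /= (zP 1%N) (zP 3%N).
move=> [[R0 R2] R4] [[W2 W4] W0] [[t1 t3] t5] [[s2 s4] s0].
rewrite !big_ord_recl big_ord0 /Xfactor /= /bump /=.
rewrite W0 W2 W4 t1 t3 t5 R0 R2 R4.
move: (negpart (c 0%N)) (negpart (c 2%N)) (negpart (c 4%N)) s0 s2 s4.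
move=> t0 t2 t4 s0 s2 s4.
have -> : c 1%N = t4 - t0 - t2 by lia.
have -> : c 3%N = t0 - t2 - t4 by lia.
have -> : c 5%N = t2 - t4 - t0 by lia.
rewrite !opprD !opprK !expfzDr // !expfzMl !exprz_inv ?opprK -!invr_expz.
by field; rewrite !expfz_neq0.
Qed.

(** Same scheme as in type B2.  Here the even-indexed [z k] are not monomials in
    the odd-indexed [1 + z m]; all of them are monomials in [z 0] and in
    [1 + z m] for [m = 1, 3, 7], and the exponents depend on [t_0], [t_2], [t_4]
    and [c 1], where [t_k = negpart (c k)]. *)
Lemma Xmonodromy_G2 : (forall m, b m = if odd m then 1 else 3)%N -> n = 8%N ->
  \prod_(m < 8) Xfactor z c m = 1.
Proof.
move=> bE n8; have := tropical_period bn cE; have := Ysystem_period bn zY.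
rewrite n8 => zP cP.
have [z8 z9] := (zP 0%N, zP 1%N); have [c8 c9] := (cP 0%N, cP 1%N).
rewrite /= in z8 z9 c8 c9.
have [_ _ R] := Ysystem_G2 zY bE.
have {R}R : 1 + z 5%N = (1 + z 3%N) * (1 + z 7%N) / (1 + z 1%N).
  by apply/(canRL (mulfK _)) => //; rewrite mulrC.
have b_odd m : odd m -> b m = 1%N by rewrite bE => ->.
have b_even m : ~~ odd m -> b m = 3%N by rewrite bE => /negPf ->.
have W m : odd m -> 1 + z m.+1 = z m.+2 * z m by move=> om; rewrite zE bE om.
have Z m x y : ~~ odd m -> z m.+2 = x -> 1 + z m.+1 = y -> x = y * y * y / z m.
  move=> em <- <-; apply/(canRL (mulfK _)) => //; rewrite zE b_even //.
  by rewrite !exprS expr0 mulr1 mulrA.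
have t m : ~~ odd m -> - negpart (c m.+1) = c m.+2 + c m.
  by move=> em; rewrite cE b_odd ?oddS //; lia.
have t' m : odd m -> negpart (c m.+1) *+ 3 = - (c m.+2 + c m).
  by move=> om; rewrite cE b_even ?oddS ?negbK //; lia.
have := (t' 1%N isT, t' 3%N isT, t' 5%N isT, t' 7%N isT); rewrite c8 c9.
have := (t 0%N isT, t 2%N isT, t 4%N isT, t 6%N isT); rewrite c8.
have := (W 1%N isT, W 3%N isT, W 5%N isT, W 7%N isT); rewrite z8 z9.
have Z2 := Z 0%N _ _ isT erefl erefl; have Z4 := Z 2%N _ _ isT erefl erefl.
have Z6 : z 6%N = (1 + z 7%N) * (1 + z 7%N) * (1 + z 7%N) / z 0%N.
  apply/(canRL (mulfK _)) => //; rewrite -z8 mulrC zE b_even //.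
  by rewrite !exprS expr0 mulr1 mulrA.
move=> [[[W2 W4] W6] W0] [[[t1 t3] t5] t7] [[[s2 s4] s6] s0].
rewrite !big_ord_recl big_ord0 /Xfactor /= /bump /=.
rewrite W0 W2 W4 W6 t1 t3 t5 t7 Z6 Z4 Z2 R.
move: (negpart (c 0%N)) (negpart (c 2%N)) (negpart (c 4%N)) (negpart (c 6%N))
  s0 s2 s4 s6 => t0 t2 t4 t6 s0 s2 s4 s6.
(* Alternating sum of the four relations [3 t_k = - (c_(k-1) + c_(k+1))]: the
   tropical image of the extra identity. *)
have -> : t6 = t0 + t4 - t2 by lia.
have -> : c 3%N = - c 1%N - t2 - t2 - t2 by lia.
have -> : c 5%N = c 1%N + t2 + t2 + t2 - t4 - t4 - t4 by lia.
have -> : c 7%N = - c 1%N - t0 - t0 - t0 by lia.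
rewrite !(expfzMl, exprz_inv) !opprD !opprK !expfzDr // -!invr_expz.
by field; rewrite !expfz_neq0.
Qed.

End Monodromy.

(** A product over a full period does not depend on its starting point, so the
    weights [(1, p)] reduce to [(p, 1)] by a shift. *)
Lemma Xmonodromy (F : fieldType) b n (z : nat -> F) (c : nat -> int) :
  rank2_exchange b n -> Ysystem b z ->
  (forall m, c m.+2 = - c m - (b m.+1)%:R * negpart (c m.+1)) ->
  \prod_(m < n) Xfactor z c m = 1.
Proof.
move=> bn zY cE; have bn1 := rank2_exchange_shift 1 bn.
have zY1 := Ysystem_shift 1 zY; pose c1 m := c (m + 1)%N.
have c1E m : c1 m.+2 = - c1 m - (b (m.+1 + 1)%N)%:R * negpart (c1 m.+1).
  by rewrite /c1 !addSn cE.
have shift : \prod_(m < n) Xfactor (fun m => z (m + 1)%N) c1 m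
           = \prod_(m < n) Xfactor z c m.
  have per m : Xfactor z c (m + n)%N = Xfactor z c m.
    by rewrite /Xfactor (Ysystem_period bn zY) (tropical_period bn cE).
  have F0 : Xfactor z c 0 != 0.
    by case: zY => nz nz1 _; rewrite mulf_neq0 ?expfz_neq0.
  apply: (mulfI F0); transitivity (\prod_(m < n.+1) Xfactor z c m).
    by rewrite big_ord_recl; congr (_ * _); apply: eq_bigr => m _;
      rewrite /Xfactor /c1 /bump addn1.
  by rewrite big_ord_recr /= mulrC -(per 0%N).
have /rank2_exchangeP[p [q [bE pqn]]] := bn.
have b1E m : b (m + 1)%N = if odd m then p else q.
  by rewrite bE addn1 /=; case: odd.
move: pqn; rewrite !inE => /or4P[| | |/or3P[| |]] /eqP[pE qE nE];
  subst p q n.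
- by apply: (Xmonodromy_A1A1 zY cE) => // m; rewrite bE if_same.
- by apply: (Xmonodromy_A2 bn zY cE) => // m; rewrite bE if_same.
- by rewrite -shift; apply: (Xmonodromy_B2 bn1 zY1 c1E b1E erefl).
- exact: (Xmonodromy_B2 bn zY cE bE erefl).
- by rewrite -shift; apply: (Xmonodromy_G2 bn1 zY1 c1E b1E erefl).
- exact: (Xmonodromy_G2 bn zY cE bE erefl).
Qed.

(** * Exchange relations with monomial coefficients *)
Section Exchange.
Variables (F : fieldType) (I : finType) (D : pred I) (x : I -> F).
Hypothesis nzx : forall l, x l != 0.

Definition monomial (v : I -> int) := \prod_(l | D l) x l ^ v l.

Lemma monomial_neq0 v : monomial v != 0.
Proof. by apply/prodf_neq0 => l _; apply: expfz_neq0. Qed.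

Lemma eq_monomial v w : (forall l, D l -> v l = w l) -> monomial v = monomial w.
Proof. by move=> vw; apply: eq_bigr => l Dl; rewrite vw. Qed.

Lemma monomialM v w : monomial v * monomial w = monomial (fun l => v l + w l).
Proof. by rewrite -big_split; apply: eq_bigr => l _; rewrite expfzDr. Qed.

Lemma monomialX v k : monomial v ^+ k = monomial (fun l => v l *+ k).
Proof.
elim: k => [|k IHk]; last first.
  by rewrite exprS IHk monomialM; apply: eq_monomial => l _; rewrite mulrS.
by rewrite expr0 /monomial big1 // => l _; rewrite mulr0n expr0z.
Qed.

Variables (b : nat -> nat) (n : nat) (a : nat -> F) (u : nat -> I -> int).
Hypothesis bn : rank2_exchange b n.
Hypothesis nza : forall m, a m != 0.
Hypothesis aE : forall m, a m.+2 * a m = monomial (fun l => pospart (u m l))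
  + monomial (fun l => negpart (u m l)) * a m.+1 ^+ b m.
Hypothesis uE : forall l, D l -> forall m,
  u m.+2 l = - u m l + (b m)%:R * pospart (u m.+1 l).

(** The ratio of the two terms on the right-hand side of the exchange relation:
    the pullback, under the map from the A-torus to the X-torus, of the inverse
    of the mutated X-coordinate. *)
Definition Yhat m := a m.+1 ^+ b m / monomial (u m).

Let C m := monomial (fun l => pospart (u m l)) * (1 + Yhat m).

Lemma exchange_factor m : a m.+2 * a m = C m.
Proof.
rewrite aE /C mulrDr mulr1; congr (_ + _).
rewrite /Yhat mulrCA mulrC; congr (_ * _).
apply/(canRL (mulfK _)); first exact: monomial_neq0.
by rewrite monomialM; apply: eq_monomial => l _; rewrite /pospart /negpart; lia.
Qed.

(** The exchange relation at [m.+1] gives [1 + Yhat m.+1] as a product of two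
    values of [a] over a coefficient, and the recurrence of [u] matches that
    coefficient with those of [Yhat m.+2] and [Yhat m]. *)
Lemma exchange_Ysystem : Ysystem b Yhat.
Proof.
split=> m.
- by rewrite mulf_neq0 ?invr_eq0 ?expf_neq0 ?monomial_neq0.
- have : C m != 0 by rewrite -exchange_factor mulf_neq0.
  by rewrite mulf_eq0 => /norP[].
have b2 : b m.+2 = b m by case: bn.
have -> : 1 + Yhat m.+1 =
    a m.+3 * a m.+1 / monomial (fun l => pospart (u m.+1 l)).
  by rewrite exchange_factor /C mulrAC mulfV ?mul1r ?monomial_neq0.
rewrite /Yhat b2 mulf_div -exprMn expr_div_n; congr (_ / _).
rewrite monomialX monomialM; apply: eq_monomial => l Dl.
by rewrite uE // addrAC addNr add0r mulr_natl.
Qed.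

Lemma exchange_coef_period l : D l -> forall m, u (m + n)%N l = u m l.
Proof.
by move=> Dl; apply: tropical_period_pospart bn (uE Dl).
Qed.

Lemma exchange_factor_period m : C (m + n)%N = C m.
Proof.
rewrite /C (Ysystem_period bn exchange_Ysystem); congr (_ * _).
by apply: eq_monomial => l Dl; rewrite exchange_coef_period.
Qed.

Lemma exchange_period_prev m : a (m.+2 + n)%N = a m.+2 -> a (m + n)%N = a m.
Proof.
move=> a2; apply: (mulfI (nza m.+2)); rewrite -{1}a2 !addSn.
by rewrite !exchange_factor exchange_factor_period.
Qed.

(** Where the weight is [1], the term [a m.+1] is a monomial multiple of
    [Yhat m], which is periodic. *)
Lemma exchange_period_linear m : b m = 1%N -> a (m.+1 + n)%N = a m.+1.
Proof.
have aYhat k : b k = 1%N -> a k.+1 = Yhat k * monomial (u k).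
  by rewrite /Yhat => ->; rewrite divfK ?monomial_neq0.
move=> bm; have bmn : b (m + n)%N = 1%N.
  rewrite -bm; have /rank2_exchangeP[p [q [bE]]] := bn.
  by rewrite !bE oddD !inE => /or4P[| | |/or3P[| |]] /eqP[-> -> ->];
    rewrite ?addbF ?if_same.
rewrite addSn !aYhat // (Ysystem_period bn exchange_Ysystem); congr (_ * _).
by apply: eq_monomial => l Dl; rewrite exchange_coef_period.
Qed.

(** If the weights vanish, the right-hand sides [C m] two steps apart agree.  If
    the weight at index [1] is [1], then [a 2] returns and the exchange relation
    propagates this to [a 0].  Otherwise the even-indexed terms are known only
    up to [p]-th roots; chaining the relations at even indices expresses [a 8]
    through [a 0] or [a 2], and what remains is an identity between the [C m]:
    the extra identity of the Y-system together with its tropical counterpart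
    for the coefficients. *)
Lemma exchange_return : a n = a 0%N.
Proof.
have [b2 _] := bn; have /rank2_exchangeP[p [q [bE]]] := bn.
have nz642 : a 6%N * a 4%N * a 2%N != 0 by rewrite !mulf_neq0.
have Yp := Ysystem_period bn exchange_Ysystem.
have Cp := exchange_factor_period; have up := exchange_coef_period.
have uP l m : D l -> u m.+2 l + u m l = (b m)%:R * pospart (u m.+1 l).
  by move=> Dl; rewrite uE //; lia.
have prev := @exchange_period_prev 0%N; rewrite add0n in prev.
have prev1 : b 1%N = 1%N -> a n = a 0%N.
  by move=> b1; apply: prev; apply: exchange_period_linear.
have Y1 := Ysystem_shift 1 exchange_Ysystem.
have b1E : forall m, b (m + 1)%N = if odd m then p else q.
  by move=> m; rewrite bE addn1 /=; case: odd.
rewrite !inE => /or4P[| | |/or3P[| |]] /eqP[pE qE nE];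
  rewrite {}pE {}qE in bE b1E; move: Yp Cp up prev; rewrite nE => Yp Cp up prev.
- have CE m : C m = monomial (fun l => pospart (u m l))
                    + monomial (fun l => negpart (u m l)).
    by rewrite -exchange_factor aE bE if_same expr0 mulr1.
  apply: (mulfI (nza 2%N)); rewrite mulrC !exchange_factor !CE addrC.
  congr (_ + _); apply: eq_monomial => l Dl;
    by move: (uP l 0%N Dl); rewrite bE mul0r /pospart /negpart; lia.
- by rewrite -nE prev1 // bE.
- apply: prev; have [_ _ YW] := Ysystem_B2 Y1 b1E.
  have a22 : a 2%N ^+ 2 = monomial (u 1%N) * Yhat 1.
    by rewrite mulrC /Yhat bE /= divfK ?monomial_neq0.
  have CC : C 6%N * C 2%N = C 4%N * a 2%N ^+ 2.
    rewrite !addn1 in YW; rewrite /C a22 mulrACA [RHS]mulrACA !monomialM.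
    rewrite (mulrC (1 + Yhat 4%N)) YW [_ * (1 + Yhat 6%N)]mulrC.
    congr (_ * _); apply: eq_monomial => l Dl.
    have := (uP l 1%N Dl, uP l 3%N Dl, uP l 5%N Dl).
    by rewrite !bE /= (up l Dl 1%N) => -[[]]; lia.
  rewrite -!exchange_factor in CC; apply: (mulIf nz642).
  by transitivity (a 8%N * a 6%N * (a 4%N * a 2%N)); [ring | rewrite CC; ring].
- by rewrite -nE prev1 // bE.
- have [_ _ YW] := Ysystem_G2 Y1 b1E.
  have CC : C 6%N * C 2%N = C 4%N * C 0%N.
    rewrite -(Cp 0%N) add0n /C mulrACA [RHS]mulrACA !monomialM.
    congr (_ * _); last by rewrite mulrC.
    apply: eq_monomial => l Dl.
    have := (uP l 1%N Dl, uP l 3%N Dl, uP l 5%N Dl, uP l 7%N Dl).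
    by rewrite !bE /= (up l Dl 1%N) => -[[[]]]; lia.
  rewrite -!exchange_factor in CC; apply: (mulIf nz642).
  by transitivity (a 8%N * a 6%N * (a 4%N * a 2%N)); [ring | rewrite CC; ring].
- by rewrite -nE prev1 // bE.
Qed.

End Exchange.

Lemma exchange_period (F : fieldType) (I : finType) (D : pred I) (x : I -> F)
    b n (a : nat -> F) (u : nat -> I -> int) :
  (forall l, x l != 0) -> rank2_exchange b n -> (forall m, a m != 0) ->
  (forall m, a m.+2 * a m = monomial D x (fun l => pospart (u m l))
     + monomial D x (fun l => negpart (u m l)) * a m.+1 ^+ b m) ->
  (forall l, D l -> forall m,
     u m.+2 l = - u m l + (b m)%:R * pospart (u m.+1 l)) ->
  forall m, a (m + n)%N = a m.
Proof.
move=> nzx bn nza aE uE m; rewrite addnC.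
apply: (@exchange_return _ _ D x nzx _ n (fun k => a (k + m)%N)
         (fun k => u (k + m)%N) (rank2_exchange_shift m bn)) => //.
- by move=> k; rewrite !addSn aE.
- by move=> l Dl k; rewrite !addSn uE.
Qed.

Lemma pospartE (x : int) : pospart x = x + negpart x.
Proof. by rewrite /pospart /negpart; lia. Qed.

(** The increment of [e] is [c * pospart u + negpart c * u].  By the two
    recurrences it is the difference of consecutive values of the skew form [w]
    below, which is periodic; this requires dividing by the weights.  If the
    weights vanish, increments two steps apart cancel. *)
Lemma entry_return b n (c u : nat -> int) (e : nat -> rat) :
  rank2_exchange b n ->
  (forall m, c m.+2 = - c m - (b m.+1)%:R * negpart (c m.+1)) ->
  (forall m, u m.+2 = - u m + (b m)%:R * pospart (u m.+1)) ->
  (forall m, e m.+1 = e m + (c m * pospart (u m) + negpart (c m) * u m)%:~R) ->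
  e n = e 0%N.
Proof.
move=> bn cE uE eE; have [b2 _] := bn.
have cP := tropical_period bn cE.
have uP := tropical_period_pospart bn uE.
have [p [q [bE pqn]]] := rank2_exchangeP bn.
have [p0|p0] := eqVneq p 0%N.
  have [q0 n4] : q = 0%N /\ n = 4%N.
    by move: pqn; rewrite p0 !inE !xpair_eqE /= !orbF => /andP[/eqP -> /eqP ->].
  have {}bE m : b m = 0%N by rewrite bE p0 q0 if_same.
  rewrite n4.
  pose d m := c m * pospart (u m) + negpart (c m) * u m.
  have dd m : d m.+2 = - d m.
    rewrite /d cE uE !bE !mul0r subr0 addr0.
    have -> : negpart (- c m) = pospart (c m) by rewrite /negpart opprK.
    have -> : pospart (- u m) = negpart (u m) by [].
    by rewrite !pospartE; ring.
  by rewrite !eE -!/(d _) !dd !rmorphN /=; ring.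
have bn0 m : (b m)%:R != 0 :> rat.
  rewrite pnatr_eq0 bE; move: pqn p0.
  by rewrite !inE => /or4P[| | |/or3P[| |]] /eqP[-> -> _] //; case: odd.
pose w m : rat := (c m)%:~R * (u m.+1)%:~R / (b m.+1)%:R
                - (u m)%:~R * (c m.+1)%:~R / (b m)%:R.
have ew m : e m.+1 - w m = e 1%N - w 0%N.
  elim: m => // m <-; rewrite eE /w.
  have -> : c m.+2 = - c m - (b m.+1)%:R * negpart (c m.+1) by [].
  rewrite uE b2 !rmorphD !rmorphM !rmorphN /= !rmorphM !rmorph_nat /=.
  by field; rewrite !bn0.
have c0 : c n = c 0%N by rewrite -(cP 0%N).
have u0 : u n = u 0%N by rewrite -(uP 0%N).
have w0 : w n = w 0%N.
  have [c1 u1] : c n.+1 = c 1%N /\ u n.+1 = u 1%N.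
    by rewrite -(cP 1%N) -(uP 1%N).
  rewrite /w c0 u0 c1 u1 !bE; move: pqn; rewrite !inE.
  by move=> /or4P[| | |/or3P[| |]] /eqP[-> -> ->].
have := ew n; rewrite w0 => /addIr; rewrite !eE c0 u0; exact: addIr.
Qed.
(** * Partial evaluation of fractions *)
Section PartialEvaluation.
Variables (A : idomainType) (E F : fieldType).
Variables (iota : {rmorphism A -> E}) (phi : {rmorphism A -> F}).
Hypothesis iota_inj : injective iota.

(** The graph of the extension of [phi] to the fractions that have a
    representative with a denominator not killed by [phi].  A relation avoids
    any choice of representatives, and it makes sense before [phi] is known to
    be injective. *)
Definition evaluates u v :=
  exists P Q : A, [/\ phi Q != 0, u = iota P / iota Q & v = phi P / phi Q].

Lemma iota_neq0 Q : phi Q != 0 -> iota Q != 0.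
Proof.
apply: contraNneq => Q0; suff -> : Q = 0 by rewrite rmorph0.
by apply: iota_inj; rewrite rmorph0. Qed.

Lemma evaluates_fun u v w : evaluates u v -> evaluates u w -> v = w.
Proof.
case=> [P [Q [nzQ -> ->]]] [P' [Q' [nzQ' /eqP eqF ->]]].
apply/eqP; move: eqF; rewrite !eqr_div ?iota_neq0 //.
by rewrite -!rmorphM => /eqP/iota_inj ->.
Qed.

Lemma evaluates_iota P : evaluates (iota P) (phi P).
Proof. by exists P, 1; rewrite !rmorph1 !divr1 oner_neq0. Qed.

Lemma evaluates0 : evaluates 0 0.
Proof. by have := evaluates_iota 0; rewrite !rmorph0. Qed.

Lemma evaluates1 : evaluates 1 1.
Proof. by have := evaluates_iota 1; rewrite !rmorph1. Qed.

Lemma evaluatesD u v u' v' :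
  evaluates u v -> evaluates u' v' -> evaluates (u + u') (v + v').
Proof.
case=> [P [Q [nzQ -> ->]]] [P' [Q' [nzQ' -> ->]]].
exists (P * Q' + P' * Q), (Q * Q').
by rewrite !addf_div ?iota_neq0 // !rmorphD !rmorphM mulf_neq0.
Qed.

Lemma evaluatesM u v u' v' :
  evaluates u v -> evaluates u' v' -> evaluates (u * u') (v * v').
Proof.
case=> [P [Q [nzQ -> ->]]] [P' [Q' [nzQ' -> ->]]].
by exists (P * P'), (Q * Q'); rewrite !mulf_div !rmorphM mulf_neq0.
Qed.

Lemma evaluatesN u v : evaluates u v -> evaluates (- u) (- v).
Proof.
case=> [P [Q [nzQ -> ->]]]; exists (- P), Q.
by rewrite !rmorphN !mulNr.
Qed.

Lemma evaluatesV u v : v != 0 -> evaluates u v -> evaluates u^-1 v^-1.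
Proof.
move=> nzv [P [Q [nzQ -> eqv]]]; exists Q, P; split; rewrite ?eqv ?invf_div //.
by move: nzv; rewrite eqv mulf_eq0 => /norP[].
Qed.

Lemma evaluatesX u v n : evaluates u v -> evaluates (u ^+ n) (v ^+ n).
Proof.
move=> uv; elim: n => [|n IHn]; first by rewrite !expr0; apply: evaluates1.
by rewrite !exprS; apply: evaluatesM.
Qed.

Lemma evaluatesXz u v (n : int) :
  v != 0 -> evaluates u v -> evaluates (u ^ n) (v ^ n).
Proof.
move=> nzv uv; case: n => n; first exact: evaluatesX.
rewrite NegzE -!exprnN; apply: evaluatesV (evaluatesX _ uv).
exact: expf_neq0.
Qed.

Lemma evaluates_prod (T : finType) (P : pred T) u v :
  (forall t, P t -> evaluates (u t) (v t)) ->
  evaluates (\prod_(t | P t) u t) (\prod_(t | P t) v t).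
Proof.
move=> uv; elim/big_ind2: _ => // [|????]; first exact: evaluates1.
exact: evaluatesM.
Qed.

(** The next two lemmas evaluate the mutation formulas at the formulas of the
    inverse mutation; [y] is the coordinate of the mutated vertex. *)
Lemma evaluates_mutX (x y : E) (x' y' : F) (c t : int) :
  y' != 0 -> 1 + y' != 0 ->
  evaluates x (x' * (1 + y') ^ c * y' ^ t) -> evaluates y^-1 y' ->
  evaluates (x * (1 + y^-1) ^ (- c) * y^-1 ^ (- t)) x'.
Proof.
move=> nzy nz1y evx evy.
have -> : x' = x' * (1 + y') ^ c * y' ^ t * (1 + y') ^ (- c) * y' ^ (- t).
  rewrite -!invr_expz [_ * y' ^ t / _]mulrAC mulfK ?expfz_neq0 //.
  by rewrite mulfK ?expfz_neq0.
apply: evaluatesM (evaluatesXz _ nzy evy); apply: evaluatesM evx _.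
apply: (evaluatesXz _ nz1y); exact: evaluatesD evaluates1 evy.
Qed.

Lemma evaluates_mutA (M y : E) (M' y' : F) :
  M' != 0 -> y' != 0 -> evaluates M M' -> evaluates y (M' / y') ->
  evaluates (M / y) y'.
Proof.
move=> nzM nzy evM evy; have -> : y' = M' / (M' / y').
  by rewrite invf_div mulrCA mulfV // mulr1.
by apply: evaluatesM evM (evaluatesV _ evy); rewrite mulf_neq0 ?invr_eq0.
Qed.

Lemma evaluates_morphism (f : E -> F) :
  (forall u, evaluates u (f u)) ->
  exists2 psi : {rmorphism E -> F}, f =1 psi & forall P, psi (iota P) = phi P.
Proof.
move=> ev; have eqf u v : evaluates u v -> f u = v := evaluates_fun (ev u).
have addP : zmod_morphism f.
  by move=> u v; apply: eqf; apply: evaluatesD => //; apply: evaluatesN.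
have mulP : monoid_morphism f.
  split; first by apply: eqf evaluates1.
  by move=> u v; apply: eqf; apply: evaluatesM.
pose fA := GRing.isZmodMorphism.Build _ _ f addP.
pose fM := GRing.isMonoidMorphism.Build _ _ f mulP.
pose psi : {rmorphism E -> F} := HB.pack f fA fM.
by exists psi => // P; apply: eqf (evaluates_iota P).
Qed.

End PartialEvaluation.

(** * Pullbacks as embeddings of function fields *)
Section Pullback.
Variable K : fieldType.
Local Notation frac := (@FracField.tofrac {mpoly K[_]}).

Lemma tofrac_inj (R : idomainType) : injective (@FracField.tofrac R).
Proof. by move=> x y /eqP; rewrite tofrac_eq => /eqP. Qed.

Lemma fracE (R : idomainType) (u : {fraction R}) :
  let r := generic_quotient.repr u in
  u = FracField.tofrac \n_r / FracField.tofrac \d_r.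
Proof.
move=> r; apply/(canRL (mulfK _)); first by rewrite tofrac_eq0 denom_ratioP.
rewrite -[u in LHS]generic_quotient.reprK -/r.
rewrite /FracField.tofrac; unlock; rewrite -[LHS]FracField.pi_mul.
apply/generic_quotient.eqmodP; rewrite /= FracField.equivfE /FracField.mulf.
by rewrite !numden_Ratio ?mulr1 ?oner_neq0 ?denom_ratioP // mulrC.
Qed.

HB.instance Definition _ (I J : finType) (f : J -> funfield K I) :=
  GRing.RMorphism.copy (poly_pullback f)
    (mmap (@FracField.tofrac {mpoly K[#|I|]} \o @mpolyC #|I| K)
          (f \o enum_val)).

Lemma poly_pullbackC (I J : finType) (f : J -> funfield K I) c :
  poly_pullback f c%:MP = frac c%:MP.
Proof.
exact: (mmapC _ (@FracField.tofrac {mpoly K[#|I|]} \o @mpolyC #|I| K)).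
Qed.

Lemma poly_pullbackX (I J : finType) (f : J -> funfield K I) j :
  poly_pullback f 'X_(enum_rank j) = f j.
Proof.
rewrite -[j in RHS]enum_rankK -[RHS](mmap1U (f \o enum_val)).
exact: (mmapX _ (@FracField.tofrac {mpoly K[#|I|]} \o @mpolyC #|I| K)).
Qed.

Definition regular_at (I J : finType) (f : J -> funfield K I) :=
  @evaluates _ (funfield K J) (funfield K I) (@FracField.tofrac _)
     (poly_pullback f).

Lemma evaluates_coord (I J : finType) (f : J -> funfield K I) j :
  regular_at f (coord K j) (f j).
Proof.
rewrite -[X in regular_at _ _ X]poly_pullbackX; exact: evaluates_iota.
Qed.

Definition field_embedding (I J : finType) (F : funfield K J -> funfield K I) :=
  exists2 phi : {rmorphism funfield K J -> funfield K I}, F =1 phi &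
    forall c : K, phi (frac c%:MP) = frac c%:MP.

Variables (I J : finType).
Variables (f : J -> funfield K I) (g : I -> funfield K J).
Hypothesis fgK : forall j, regular_at g (f j) (coord K j).

Lemma regular_at_poly_pullback P : regular_at g (poly_pullback f P) (frac P).
Proof.
elim/mpolyind: P => [|c m P _ _ IH].
  by rewrite !rmorph0; apply: evaluates0.
rewrite !rmorphD /=; apply: evaluatesD IH; first exact: tofrac_inj.
rewrite -mul_mpolyC !rmorphM /=; apply: evaluatesM.
  by rewrite poly_pullbackC -(poly_pullbackC g); apply: evaluates_iota.
rewrite mpolyXE_id !rmorph_prod; apply: evaluates_prod => t _.
rewrite !rmorphXn; apply: evaluatesX; have := fgK (enum_val t).
by rewrite /coord -(poly_pullbackX f) enum_valK.
Qed.

(** Evaluating [poly_pullback f P] at [g] gives back [P], so the substitution of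
    [f] is injective: the family [f] is algebraically independent. *)
Lemma poly_pullback_eq0 P : (poly_pullback f P == 0) = (P == 0).
Proof.
apply/eqP/eqP => [P0|->]; last exact: rmorph0.
apply: (@tofrac_inj {mpoly K[#|J|]}); rewrite [RHS]rmorph0.
apply: (evaluates_fun _ (regular_at_poly_pullback P)); first exact: tofrac_inj.
by rewrite P0; apply: evaluates0.
Qed.

Lemma pullback_embedding :
  field_embedding (pullback f) /\ forall j, pullback f (coord K j) = f j.
Proof.
have [||phi fphi phiE] := @evaluates_morphism _ (funfield K J) (funfield K I)
  (@FracField.tofrac _) (poly_pullback f) _ (pullback f).
- exact: tofrac_inj.
- move=> u; exists \n_(generic_quotient.repr u), \d_(generic_quotient.repr u).
  by split=> //; [rewrite poly_pullback_eq0 denom_ratioP | exact: fracE].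
split=> [|j]; last first.
  by rewrite fphi; apply: (etrans (phiE _)); apply: poly_pullbackX.
by exists phi => // c; apply: (etrans (phiE _)); apply: poly_pullbackC.
Qed.

End Pullback.

Lemma eps_diag (I : finType) (s : seed I) k : eps s k k = 0.
Proof.
have /and4P[_ /forallP/(_ k) dk _ /forallP/(_ k)/forallP/(_ k)/eqP] := seedP s.
have nzd : (mult s k)%:R != 0 :> rat by rewrite pnatr_eq0 -lt0n.
rewrite /eps_hat => /(congr1 ( *%R^~ (mult s k)%:R)).
by rewrite mulNr !divfK //; lra.
Qed.

(** * Mutations as embeddings *)

(** The mutation formulas with arbitrary values in a field in place of the
    coordinates: an embedding maps the mutated coordinates to the mutation of
    the values of the coordinates. *)
Section MutationValues.
Variables (L : fieldType) (I : finType) (s : seed I) (k : I) (y : I -> L).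

Definition mutX_at l :=
  if l == k then (y k)^-1
  else y l * (1 + y k ^ (- sgz (eps s l k))) ^ (- numq (eps s l k)).

Definition mutA_num :=
  \prod_(j | 0 < eps s k j) y j ^ numq (eps s k j)
    + \prod_(j | eps s k j < 0) y j ^ (- numq (eps s k j)).

Definition mutA_at l := if l == k then mutA_num / y k else y l.

Lemma mutX_atE l : y k != 0 -> 1 + y k != 0 -> l != k ->
  let c := numq (eps s l k) in
  mutX_at l = y l * (1 + (y k)^-1) ^ (- c) * (y k)^-1 ^ (- negpart c).
Proof.
move=> nzy nz1y nlk c; rewrite /mutX_at (negPf nlk) -sgr_numq -/c -mulrA.
congr (_ * _); rewrite /negpart; case: (sgzP c) => [->|c_gt0|c_lt0].
- by rewrite oppr0 !expr0z mulr1.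
- by rewrite max_r ?oppr_le0 1?ltW // oppr0 expr0z mulr1 -exprN1.
rewrite max_l ?oppr_ge0 1?ltW // opprK expr1z exprz_inv opprK -expfzMl.
by congr (_ ^ _); rewrite mulrDl mul1r mulVf // addrC.
Qed.

End MutationValues.

Lemma eq_mutX_at (L : fieldType) (I : finType) (s : seed I) k (y y' : I -> L) :
  y =1 y' -> mutX_at s k y =1 mutX_at s k y'.
Proof. by move=> yy' l; rewrite /mutX_at !yy'. Qed.

Lemma eq_mutA_at (L : fieldType) (I : finType) (s : seed I) k (y y' : I -> L) :
  y =1 y' -> mutA_at s k y =1 mutA_at s k y'.
Proof.
move=> yy' l; rewrite /mutA_at /mutA_num !yy'; case: ifP => // _.
by congr ((_ + _) / _); apply: eq_bigr => j _; rewrite yy'.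
Qed.

Section Embeddings.
Variable K : fieldType.

Lemma mutX_morph (I J : finType) (s : seed I) k l
    (phi : {rmorphism funfield K I -> funfield K J}) :
  phi (mutX K s k l) = mutX_at s k (phi \o @coord K I) l.
Proof.
rewrite /mutX /mutX_at; case: ifP => _; first exact: fmorphV.
by rewrite rmorphM fmorphXz rmorphD rmorph1 fmorphXz.
Qed.

Lemma mutA_morph (I J : finType) (s : seed I) k l
    (phi : {rmorphism funfield K I -> funfield K J}) :
  phi (mutA K s k l) = mutA_at s k (phi \o @coord K I) l.
Proof.
rewrite /mutA /mutA_at /mutA_num; case: ifP => // _.
rewrite fmorph_div rmorphD !rmorph_prod.
by congr ((_ + _) / _); apply: eq_bigr => j _; rewrite fmorphXz.
Qed.

Section Nonzero.
Hypothesis charK : [pchar K] =i pred0.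
Variable I : finType.

(** Evaluation at the point with all coordinates [1] detects nonzero functions:
    [1 + x_k] and the exchange binomial take there the value [2], which is
    nonzero in characteristic [0]. *)
Definition regular_at_one : funfield K I -> K -> Prop :=
  @evaluates _ (funfield K I) K (@FracField.tofrac _) (meval (fun=> 1)).

Lemma regular_at_one_coord l : regular_at_one (coord K l) 1.
Proof.
rewrite -[X in regular_at_one _ X](mevalXU (fun=> 1) (enum_rank l)).
exact: evaluates_iota.
Qed.

Lemma regular_at_one_neq0 u : regular_at_one u 2 -> u != 0.
Proof.
move=> ev; apply: contraTneq isT => u0.
have /eqP : 2 = 0 :> K.
  apply: (evaluates_fun _ ev); first exact: tofrac_inj.
  by rewrite u0; apply: evaluates0.
have /charf0P -> := charK; by [].
Qed.

Lemma coord_neq0 l : coord K l != 0 :> funfield K I.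
Proof.
rewrite /coord tofrac_eq0; apply/eqP => /(congr1 (meval (fun=> 1))).
by rewrite mevalXU meval0 => /eqP; rewrite oner_eq0.
Qed.

Lemma coordD1_neq0 l : 1 + coord K l != 0 :> funfield K I.
Proof.
apply: regular_at_one_neq0; apply: evaluatesD; first exact: tofrac_inj.
  exact: evaluates1.
exact: regular_at_one_coord.
Qed.

Lemma regular_at_one_monomial (P : pred I) (n : I -> int) :
  regular_at_one (\prod_(l | P l) coord K l ^ n l) 1.
Proof.
have -> : 1 = \prod_(l | P l) (1 : K) ^ n l.
  by rewrite big1 // => l _; rewrite exp1rz.
apply: evaluates_prod => l _; apply: evaluatesXz; first exact: oner_neq0.
exact: regular_at_one_coord.
Qed.

Lemma mutA_num_neq0 s k : mutA_num s k (@coord K I) != 0.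
Proof.
apply: regular_at_one_neq0; apply: evaluatesD; first exact: tofrac_inj.
  exact: regular_at_one_monomial.
exact: regular_at_one_monomial.
Qed.

(** The inverse family [g] is the inverse mutation, written with the same sign
    convention as mutX_atE. *)
Lemma embedding_mutX (s : seed I) k : field_embedding (pullback (mutX K s k)) /\
  forall l, pullback (mutX K s k) (coord K l) = mutX K s k l.
Proof.
pose g l : funfield K I := if l == k then (coord K k)^-1
  else let c := numq (eps s l k) in
    coord K l * (1 + coord K k) ^ c * coord K k ^ negpart c.
have nzk := coord_neq0 k; have nz1k := coordD1_neq0 k.
have gk : g k = (coord K k)^-1 by rewrite /g eqxx.
have evk : regular_at g (coord K k) (coord K k)^-1.
  by rewrite -gk; apply: evaluates_coord.
have evVk : regular_at g (coord K k)^-1 (coord K k).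
  rewrite -[X in regular_at _ _ X]invrK.
  exact: (evaluatesV (invr_neq0 nzk) evk).
apply: (@pullback_embedding _ _ _ _ g) => l.
have [->|nlk] := eqVneq l k; first by rewrite /mutX eqxx.
have -> : mutX K s k l = mutX_at s k (@coord K I) l by [].
rewrite (@mutX_atE _ _ s k (@coord K I) l nzk nz1k nlk); set c := numq _.
have gl : g l = coord K l * (1 + coord K k) ^ c * coord K k ^ negpart c.
  by rewrite /g (negPf nlk).
have evl := evaluates_coord g l; rewrite gl in evl.
exact: (evaluates_mutX (@tofrac_inj _) nzk nz1k evl evVk).
Qed.

(** The exchange binomial does not involve [x_k], so these formulas are their
    own inverse. *)
Lemma embedding_mutA (s : seed I) k : field_embedding (pullback (mutA K s k)) /\
  forall l, pullback (mutA K s k) (coord K l) = mutA K s k l.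
Proof.
have nzk := coord_neq0 k; have nzM := mutA_num_neq0 s k.
have Ak : mutA K s k k = mutA_num s k (@coord K I) / coord K k.
  by rewrite /mutA eqxx.
apply: (@pullback_embedding _ _ _ _ (mutA K s k)) => l.
have ev m : m != k -> regular_at (mutA K s k) (coord K m) (coord K m).
  move=> nmk; have := evaluates_coord (mutA K s k) m.
  by rewrite {2}/mutA (negPf nmk).
have [->|nlk] := eqVneq l k; last by rewrite /mutA (negPf nlk); apply: ev.
have evk := evaluates_coord (mutA K s k) k; rewrite Ak in evk.
have evM : regular_at (mutA K s k) (mutA_num s k (@coord K I))
                      (mutA_num s k (@coord K I)).
  have pow m (c : int) : m != k ->
      regular_at (mutA K s k) (coord K m ^ c) (coord K m ^ c).
    by move=> nmk; apply: (evaluatesXz _ (coord_neq0 m) (ev m nmk)).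
  apply: evaluatesD; first exact: tofrac_inj.
    apply: evaluates_prod => m km; apply: pow.
    by apply: contraTneq km => ->; rewrite eps_diag ltxx.
  apply: evaluates_prod => m km; apply: pow.
  by apply: contraTneq km => ->; rewrite eps_diag ltxx.
rewrite Ak; exact: (evaluates_mutA nzM nzk evM evk).
Qed.

End Nonzero.

Lemma embedding_iso (I J : finType) (s : seed I) (t : seed J)
    (f : seed_iso s t) :
  field_embedding (pullback (isoM K f)) /\
  forall l, pullback (isoM K f) (coord K l) = isoM K f l.
Proof.
apply: (@pullback_embedding _ _ _ _ (fun i => coord K (iso_fun f i))) => j.
rewrite /isoM -{2}[j](iso_invK f); exact: evaluates_coord.
Qed.

Lemma embedding_id (I : finType) : field_embedding (@id (funfield K I)).
Proof. by exists idfun. Qed.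

Lemma embedding_comp (I J N : finType) (F : funfield K J -> funfield K I)
    (G : funfield K N -> funfield K J) :
  field_embedding F -> field_embedding G -> field_embedding (F \o G).
Proof.
move=> [phi Fphi phiC] [psi Gpsi psiC]; exists (phi \o psi) => [u | c] /=.
  by rewrite Gpsi Fphi.
by rewrite psiC phiC.
Qed.

Lemma embedding_pullX (charK : [pchar K] =i pred0) (I J : finType) (s : seed I)
  (t : seed J) (T : cluster_transf s t) : field_embedding (@pullX K _ _ _ _ T).
Proof.
elim: T => {I J s t} [I s|I s k hk|I J s t f|I J N s t u T2 IH2 T1 IH1] /=.
- exact: embedding_id.
- exact: (embedding_mutX charK s k).1.
- exact: (embedding_iso f).1.
- exact: embedding_comp.
Qed.

Lemma embedding_pullA (charK : [pchar K] =i pred0) (I J : finType) (s : seed I)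
  (t : seed J) (T : cluster_transf s t) : field_embedding (@pullA K _ _ _ _ T).
Proof.
elim: T => {I J s t} [I s|I s k hk|I J s t f|I J N s t u T2 IH2 T1 IH1] /=.
- exact: embedding_id.
- exact: (embedding_mutA charK s k).1.
- exact: (embedding_iso f).1.
- exact: embedding_comp.
Qed.

Lemma embedding_eq_id (I : finType) (F : funfield K I -> funfield K I) :
  field_embedding F -> (forall l, F (coord K l) = coord K l) -> F =1 id.
Proof.
move=> [phi Fphi phiC] Fx u; rewrite Fphi /=.
have phiP (P : {mpoly K[#|I|]}) : phi (FracField.tofrac P) = FracField.tofrac P.
  elim/mpolyind: P => [|c m P _ _ IH]; first by rewrite !rmorph0.
  rewrite !rmorphD /= IH; congr (_ + _).
  rewrite -mul_mpolyC !rmorphM /= phiC; congr (_ * _).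
  rewrite mpolyXE_id !rmorph_prod; apply: eq_bigr => t _.
  by rewrite !rmorphXn; congr (_ ^+ _); have := Fx (enum_val t);
    rewrite Fphi /coord enum_valK.
by rewrite [u]fracE fmorph_div !phiP.
Qed.

End Embeddings.

(** * The orbit of the seed *)
Lemma nonfrozen_col (I : finType) (s : seed I) k l : k \notin frozen s ->
  eps s l k = (numq (eps s l k))%:~R.
Proof.
move=> hk.
have /and4P[/forallP/(_ l)/forallP/(_ k)/implyP int _ _ _] := seedP s.
by rewrite numqK // int // (negPf hk) andbF.
Qed.

Lemma nonfrozen_row (I : finType) (s : seed I) k l : k \notin frozen s ->
  eps s k l = (numq (eps s k l))%:~R.
Proof.
move=> hk.
have /and4P[/forallP/(_ k)/forallP/(_ l)/implyP int _ _ _] := seedP s.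
by rewrite numqK // int // (negPf hk).
Qed.

(** The case distinction on the sign of the product in the mutation rule is
    equivalent to a single piecewise bilinear formula. *)
Lemma mut_epsE (I : finType) (s : seed I) k a b : k \notin frozen s ->
  a != k -> b != k ->
  let c := numq (eps s a k) in let u := numq (eps s k b) in
  mut_eps s k a b = eps s a b + (c * pospart u + negpart c * u)%:~R.
Proof.
move=> hk nak nbk c u.
rewrite !ffunE ![k == _]eq_sym (negPf nak) (negPf nbk) /=.
rewrite (nonfrozen_col a hk) (nonfrozen_row b hk) -/c -/u.
rewrite -intr_norm -!intrM lerz0.
case: leP => cu.
  rewrite -[LHS]addr0 -[0]/(0%:~R); congr (_ + _%:~R).
  by rewrite /pospart /negpart; nia.
by congr (_ + _%:~R); rewrite /pospart /negpart; nia.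
Qed.

Lemma mut_eps_neg (I : finType) (s : seed I) k a b : (k == a) || (k == b) ->
  mut_eps s k a b = - eps s a b.
Proof. by rewrite !ffunE => ->. Qed.

Lemma seed_eq (I : finType) (s t : seed I) : frozen s = frozen t ->
  eps s = eps t -> mult s = mult t -> s = t.
Proof.
case: s t => [f e d ax] [f' e' d' ax'] /= ff ee dd; subst f' e' d'.
by rewrite (bool_irrelevance ax ax').
Qed.

Section SigmaMuOrbit.
Variables (I : finType) (i j : I).
Hypothesis neq_ij : i != j.

(** The iteration is defined by recursion on its first step, whereas the
    recurrences need its last one. *)
Lemma sigma_mu_iterS m (s : seed I) (hi : i \notin frozen s)
    (hj : j \notin frozen s) :
  exists h : i \notin frozen (sigma_mu_iter_seed m hi hj),
    sigma_mu_iter_seed m.+1 hi hj = sigma_mu_seed j h.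
Proof.
elim: m s hi hj => [|m IHm] s hi hj; first by exists hi.
exact: (IHm (sigma_mu_seed j hi) (sigma_mu_i hi hj) (sigma_mu_j j hi)).
Qed.

Lemma frozen_sigma_mu (s : seed I) (hi : i \notin frozen s)
    (hj : j \notin frozen s) : frozen (sigma_mu_seed j hi) = frozen s.
Proof.
apply/setP => l; rewrite mem_tr_frozen tpermV /=.
by case: tpermP => // ->; rewrite (negPf hi) (negPf hj).
Qed.

Variables (s : seed I) (hi : i \notin frozen s) (hj : j \notin frozen s).

Local Notation S m := (sigma_mu_iter_seed m hi hj).

Lemma frozen_orbit m : frozen (S m) = frozen s.
Proof.
elim: m => // m IHm; have [h ->] := sigma_mu_iterS m hi hj.
by rewrite frozen_sigma_mu // IHm.
Qed.

Lemma orbit_i m : i \notin frozen (S m). Proof. by rewrite frozen_orbit. Qed.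

Lemma mult_orbit m l : mult (S m) l = mult s ((tperm i j ^+ m)%g l).
Proof.
elim: m l => [|m IHm] l; first by rewrite perm1.
have [h ->] := sigma_mu_iterS m hi hj.
by rewrite ffunE tpermV IHm expgS permM.
Qed.

Lemma eps_orbit m a b :
  eps (S m.+1) (tperm i j a) (tperm i j b) = mut_eps (S m) i a b.
Proof. by have [h ->] := sigma_mu_iterS m hi hj; rewrite tr_epsE. Qed.

Lemma eps_orbit_ij m : eps (S m.+1) i j = - eps (S m) j i.
Proof.
by have := eps_orbit m j i; rewrite tpermL tpermR mut_eps_neg ?eqxx ?orbT.
Qed.

Lemma eps_orbit_ji m : eps (S m.+1) j i = - eps (S m) i j.
Proof. by have := eps_orbit m i j; rewrite tpermL tpermR mut_eps_neg ?eqxx. Qed.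

Variables (b : nat -> nat) (n : nat).
Hypothesis bn : rank2_exchange b n.
Hypothesis eps_ij : eps s i j = - (b 0%N)%:R.
Hypothesis eps_ji : eps s j i = (b 1%N)%:R.

(** A mutation at [i] changes the signs of [eps_ij] and [eps_ji], and the
    transposition exchanges them. *)
Lemma eps_orbit_weights m :
  eps (S m) i j = - (b m)%:R /\ eps (S m) j i = (b m.+1)%:R.
Proof.
elim: m => [//|m [IHij IHji]].
by rewrite eps_orbit_ij eps_orbit_ji IHij IHji opprK; case: bn => ->.
Qed.

Definition col m l := numq (eps (S m) l i).
Definition row m l := numq (eps (S m) i l).

Section OtherVertices.
Variable l : I.
Hypothesis (li : l != i) (lj : l != j).

Let tl : tperm i j l = l. Proof. by rewrite tpermD // eq_sym. Qed.
Let ji : j != i. Proof. by rewrite eq_sym. Qed.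

Lemma eps_orbit_lj m : eps (S m.+1) l j = - (col m l)%:~R.
Proof.
have := eps_orbit m l i; rewrite tl tpermL mut_eps_neg ?eqxx ?orbT //.
by rewrite [eps _ l i]nonfrozen_col ?orbit_i.
Qed.

Lemma eps_orbit_jl m : eps (S m.+1) j l = - (row m l)%:~R.
Proof.
have := eps_orbit m i l; rewrite tl tpermL mut_eps_neg ?eqxx //.
by rewrite [eps _ i l]nonfrozen_row ?orbit_i.
Qed.

Lemma eps_orbit_li m :
  eps (S m.+1) l i = eps (S m) l j - (b m)%:R * (negpart (col m l))%:~R.
Proof.
have := eps_orbit m l j; rewrite tl tpermR mut_epsE ?orbit_i // => ->.
rewrite (eps_orbit_weights m).1 numqN -/(col m l) -[(b m)%:R]/((b m)%:Z%:~R).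
rewrite numq_int -rmorphM -rmorphN /=; congr (_ + _%:~R).
have -> : pospart (- (b m)%:Z) = 0 by rewrite /pospart; lia.
by rewrite mulr0 add0r mulrN mulrC.
Qed.

Lemma eps_orbit_il m :
  eps (S m.+1) i l = eps (S m) j l + (b m.+1)%:R * (pospart (row m l))%:~R.
Proof.
have := eps_orbit m j l; rewrite tl tpermR mut_epsE ?orbit_i // => ->.
rewrite (eps_orbit_weights m).2 -/(row m l) -[(b m.+1)%:R]/((b m.+1)%:Z%:~R).
rewrite numq_int -rmorphM /=; congr (_ + _%:~R).
have -> : negpart (b m.+1)%:Z = 0 by rewrite /negpart; lia.
by rewrite mul0r addr0.
Qed.

Lemma colE m : col m.+2 l = - col m l - (b m.+1)%:R * negpart (col m.+1 l).
Proof.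
apply: (@intr_inj rat); rewrite -[LHS]nonfrozen_col ?orbit_i //.
by rewrite eps_orbit_li eps_orbit_lj rmorphB rmorphN rmorphM /= rmorph_nat.
Qed.

Lemma rowE m : row m.+2 l = - row m l + (b m)%:R * pospart (row m.+1 l).
Proof.
apply: (@intr_inj rat); rewrite -[LHS]nonfrozen_row ?orbit_i //.
rewrite eps_orbit_il eps_orbit_jl rmorphD rmorphN rmorphM /= rmorph_nat.
by case: bn => ->.
Qed.

End OtherVertices.

Lemma eps_orbit_ll l l' m : l != i -> l != j -> l' != i -> l' != j ->
  eps (S m.+1) l l' = eps (S m) l l' +
    (col m l * pospart (row m l') + negpart (col m l) * row m l')%:~R.
Proof.
move=> li lj li' lj'; have := eps_orbit m l l'.
by rewrite !tpermD 1?eq_sym // mut_epsE ?orbit_i.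
Qed.

Lemma weights_period : b n = b 0%N /\ b n.+1 = b 1%N.
Proof.
have /rank2_exchangeP[p [q [bE]]] := bn.
by rewrite !bE !inE => /or4P[| | |/or3P[| |]] /eqP[-> -> ->].
Qed.

Lemma col_period l m : l != i -> l != j -> col (m + n) l = col m l.
Proof.
move=> li lj; apply: (@tropical_period _ _ (col^~ l) bn) => k; exact: colE.
Qed.

Lemma row_period l m : l != i -> l != j -> row (m + n) l = row m l.
Proof.
move=> li lj; apply: (@tropical_period_pospart _ _ (row^~ l) bn) => k.
exact: rowE.
Qed.

(** The entries in row and column [j] are recovered from those of [i] one step
    later. *)
Lemma orbit_return :
  (forall l, mult s ((tperm i j ^+ n)%g l) = mult s l) -> S n = s.
Proof.
move=> multP.
apply: seed_eq; first exact: frozen_orbit.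
  have [b0 b1] := weights_period.
  have [nij nji] := eps_orbit_weights n.
  have lj l : l != i -> l != j -> eps (S n) l j = eps s l j.
    move=> li lj; apply: (addIr (- ((b n)%:R * (negpart (col n l))%:~R))).
    rewrite -eps_orbit_li // b0.
    have -> : col n l = col 0%N l by rewrite -(col_period 0%N li lj).
    rewrite -[RHS](eps_orbit_li li lj 0%N).
    rewrite nonfrozen_col ?orbit_i // [RHS]nonfrozen_col ?orbit_i //.
    by rewrite -/(col n.+1 l) -/(col 1%N l) -(col_period 1%N li lj).
  have jl l : l != i -> l != j -> eps (S n) j l = eps s j l.
    move=> li lj'; apply: (addIr ((b n.+1)%:R * (pospart (row n l))%:~R)).
    rewrite -eps_orbit_il // b1.
    have -> : row n l = row 0%N l by rewrite -(row_period 0%N li lj').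
    rewrite -[RHS](eps_orbit_il li lj' 0%N).
    rewrite nonfrozen_row ?orbit_i // [RHS]nonfrozen_row ?orbit_i //.
    by rewrite -/(row n.+1 l) -/(row 1%N l) -(row_period 1%N li lj').
  apply/ffunP => x; apply/ffunP => y.
  have [->|xi] := eqVneq x i; have [->|yi] := eqVneq y i.
  - by rewrite !eps_diag.
  - have [->|yj] := eqVneq y j; first by rewrite nij b0 eps_ij.
    rewrite nonfrozen_row ?orbit_i // [RHS]nonfrozen_row // -/(row _ _).
    by rewrite -[n]add0n row_period.
  - have [->|xj] := eqVneq x j; first by rewrite nji b1 eps_ji.
    rewrite nonfrozen_col ?orbit_i // [RHS]nonfrozen_col // -/(col _ _).
    by rewrite -[n]add0n col_period.
  have [->|xj] := eqVneq x j; have [->|yj] := eqVneq y j.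
  - by rewrite !eps_diag.
  - exact: jl.
  - exact: lj.
  apply: (@entry_return b n (col^~ x) (row^~ y) (fun m => eps (S m) x y))
    => // m.
  - exact: colE.
  - exact: rowE.
  - exact: eps_orbit_ll.
by apply/ffunP => l; rewrite mult_orbit multP.
Qed.

(** * The orbits of the coordinates *)
Section OrbitValues.
Variable L : fieldType.

(** The value at [j] is the value at [i] one step earlier, inverted, so the
    value at [i] gives a Y-system; the other values are multiplied at each step
    by the factors of Xmonodromy. *)
Lemma Xorbit_return (y : nat -> I -> L) :
  (forall m l, y m l != 0) -> (forall m l, 1 + y m l != 0) ->
  (forall m l, y m.+1 l = mutX_at (S m) i (y m) (tperm i j l)) ->
  forall l, y n l = y 0%N l.
Proof.
move=> nzy nz1y yE; pose z m := (y m i)^-1.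
have yj m : y m.+1 j = z m by rewrite yE tpermR /mutX_at eqxx.
have yi m : y m.+1 i = y m j / (1 + z m) ^+ b m.+1.
  rewrite yE tpermL mutX_atE // 1?eq_sym // (eps_orbit_weights m).2.
  rewrite -[(b m.+1)%:R]/((b m.+1)%:Z%:~R) numq_int.
  have -> : negpart (b m.+1)%:Z = 0 by rewrite /negpart; lia.
  by rewrite oppr0 expr0z mulr1 -exprnN.
have yl m l : l != i -> l != j ->
    y m.+1 l = y m l * Xfactor z (col^~ l) m.
  move=> li lj; rewrite yE tpermD 1?eq_sym // mutX_atE //.
  by rewrite /Xfactor mulrA.
have zY : Ysystem b z.
  split=> m; first by rewrite invr_eq0.
    have -> : 1 + z m = (1 + y m i) / y m i.
      by rewrite mulrDl divff // mul1r addrC.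
    by rewrite mulf_neq0 ?invr_eq0.
  have b2 : b m.+2 = b m by case: bn.
  rewrite {1}/z yi yj invf_div b2 -mulrA -[RHS]mulr1; congr (_ * _).
  by rewrite mulVf // invr_eq0.
have zP := Ysystem_period bn zY.
have [b0 b1] := weights_period.
move=> l; have [->|li] := eqVneq l i.
  exact: (invr_inj (zP 0%N)).
have [->|lj] := eqVneq l j.
  have yjE m : y m j = y m.+1 i * (1 + z m) ^+ b m.+1.
    by rewrite yi divfK // expf_neq0 //; case: zY.
  rewrite !yjE b1; congr (_ * (1 + _) ^+ _); last exact: (zP 0%N).
  exact: (invr_inj (zP 1%N)).
have ym m : y m l = y 0%N l * \prod_(k < m) Xfactor z (col^~ l) k.
  elim: m => [|m IHm]; first by rewrite big_ord0 mulr1.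
  by rewrite yl // IHm big_ord_recr /= [RHS]mulrA.
rewrite ym (Xmonodromy bn zY) ?mulr1 // => m; exact: colE.
Qed.

Let others l := (l != i) && (l != j).

(** Separating the vertex [j] from the exchange binomial puts the mutation rule
    in the form of a rank 2 exchange relation whose coefficients are monomials
    in the variables that never mutate. *)
Lemma mutA_num_orbit m (y : I -> L) : (forall l, y l != 0) ->
  mutA_num (S m) i y =
    monomial others y (fun l => pospart (row m l))
      + monomial others y (fun l => negpart (row m l)) * y j ^+ b m.
Proof.
move=> nzy; have rowi : row m i = 0 by rewrite /row eps_diag.
have rowj : row m j = - (b m)%:Z.
  rewrite /row (eps_orbit_weights m).1 numqN.
  by rewrite -[(b m)%:R]/((b m)%:Z%:~R) numq_int.
have split_ij (v : I -> int) : v i = 0 ->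
    \prod_l y l ^ v l = monomial others y v * y j ^ v j.
  move=> vi; rewrite (bigD1 i) //= vi expr0z mul1r (bigD1 j) 1?eq_sym //= mulrC.
  by congr (_ * _); apply: eq_bigl => l; rewrite /others.
rewrite /mutA_num !(big_mkcond (fun l => _ < _)) /=; congr (_ + _).
- have pj : y j ^ pospart (row m j) = 1.
    by rewrite rowj (_ : pospart _ = 0) ?expr0z // /pospart; lia.
  rewrite -[RHS]mulr1 -[X in _ * X]pj -(split_ij (fun l => pospart (row m l))).
    apply: eq_bigr => l _; rewrite -numq_gt0 -/(row m l).
    by rewrite /pospart; case: ltP.
  by rewrite rowi.
- have <- : y j ^ negpart (row m j) = y j ^+ b m.
    by rewrite rowj (_ : negpart _ = (b m)%:Z) // /negpart; lia.
  rewrite -(split_ij (fun l => negpart (row m l))); last by rewrite rowi.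
  apply: eq_bigr => l _; rewrite -numq_lt0 -/(row m l) /negpart.
  case: ltP => u0; first by rewrite max_l // oppr_ge0 ltW.
  by rewrite max_r // oppr_le0.
Qed.

Lemma Aorbit_return (y : nat -> I -> L) :
  (forall m l, y m l != 0) ->
  (forall m l, y m.+1 l = mutA_at (S m) i (y m) (tperm i j l)) ->
  forall l, y n l = y 0%N l.
Proof.
move=> nzy yE; have ji : (j == i) = false by rewrite eq_sym; apply: negPf.
have yi m : y m.+1 i = y m j by rewrite yE tpermL /mutA_at ji.
have yj m : y m.+1 j = mutA_num (S m) i (y m) / y m i.
  by rewrite yE tpermR /mutA_at eqxx.
have yl m l : others l -> y m l = y 0%N l.
  move=> /andP[li lj]; elim: m => // m <-.
  by rewrite yE tpermD 1?eq_sym // /mutA_at (negPf li).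
have aP := @exchange_period _ _ others (y 0%N) b n (fun m => y m i) row
  (nzy 0%N) bn (fun m => nzy m i).
have {}aP m : y (m + n)%N i = y m i.
  apply: aP => [k|l /andP[li lj] k]; last exact: rowE.
  rewrite yi yj divfK // mutA_num_orbit // -yi.
  by congr (_ + _ * _); apply: eq_bigr => l /yl ->.
move=> l; have [->|li] := eqVneq l i; first exact: (aP 0%N).
have [->|lj] := eqVneq l j; first by rewrite -!yi -(aP 1%N).
by apply: yl; rewrite /others li.
Qed.

End OrbitValues.

End SigmaMuOrbit.

(** * Triviality of the cluster transformation *)
Section Triviality.
Variables (K : fieldType) (charK : [pchar K] =i pred0).
Variables (I : finType) (i j : I).

(** Pullbacks compose contravariantly: the embedding for [m] steps is applied to
    the formulas of step [m.+1], so the images of the coordinates mutate along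
    the orbit of seeds. *)
Lemma pullX_iterS m (s : seed I) (hi : i \notin frozen s)
    (hj : j \notin frozen s) l :
  pullX (sigma_mu_iter m.+1 hi hj) (coord K l) =
  pullX (sigma_mu_iter m hi hj)
    (mutX K (sigma_mu_iter_seed m hi hj) i (tperm i j l)).
Proof.
elim: m s hi hj => [|m IHm] s hi hj.
  rewrite /= (embedding_iso K _).2 /isoM /= tpermV.
  exact: (embedding_mutX charK s i).2.
exact: (congr1 (pullX (sigma_mu j hi))
  (IHm (sigma_mu_seed j hi) (sigma_mu_i hi hj) (sigma_mu_j j hi))).
Qed.

Lemma pullA_iterS m (s : seed I) (hi : i \notin frozen s)
    (hj : j \notin frozen s) l :
  pullA (sigma_mu_iter m.+1 hi hj) (coord K l) =
  pullA (sigma_mu_iter m hi hj)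
    (mutA K (sigma_mu_iter_seed m hi hj) i (tperm i j l)).
Proof.
elim: m s hi hj => [|m IHm] s hi hj.
  rewrite /= (embedding_iso K _).2 /isoM /= tpermV.
  exact: (embedding_mutA charK s i).2.
exact: (congr1 (pullA (sigma_mu j hi))
  (IHm (sigma_mu_seed j hi) (sigma_mu_i hi hj) (sigma_mu_j j hi))).
Qed.

Variables (s : seed I) (hi : i \notin frozen s) (hj : j \notin frozen s).
Hypothesis neq_ij : i != j.
Variables (b : nat -> nat) (n : nat).
Hypothesis bn : rank2_exchange b n.
Hypothesis eps_ij : eps s i j = - (b 0%N)%:R.
Hypothesis eps_ji : eps s j i = (b 1%N)%:R.

Lemma pullX_iter_id : pullX (sigma_mu_iter n hi hj) =1 @id (funfield K I).
Proof.
have emb m := embedding_pullX charK (sigma_mu_iter m hi hj).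
apply: embedding_eq_id (emb n) _.
pose y m l := pullX (sigma_mu_iter m hi hj) (coord K l).
apply: (@Xorbit_return _ i j neq_ij s hi hj b n bn eps_ij eps_ji _ y) => m l.
- have [phi Fphi _] := emb m.
  by rewrite /y Fphi fmorph_eq0; exact: coord_neq0.
- have [phi Fphi _] := emb m.
  rewrite /y Fphi -(rmorph1 phi) -rmorphD fmorph_eq0; exact: coordD1_neq0.
have [phi Fphi _] := emb m.
rewrite {1}/y pullX_iterS Fphi mutX_morph; apply: eq_mutX_at => l'.
exact/esym/Fphi.
Qed.

Lemma pullA_iter_id : pullA (sigma_mu_iter n hi hj) =1 @id (funfield K I).
Proof.
have emb m := embedding_pullA charK (sigma_mu_iter m hi hj).
apply: embedding_eq_id (emb n) _.
pose y m l := pullA (sigma_mu_iter m hi hj) (coord K l).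
apply: (@Aorbit_return _ i j neq_ij s hi hj b n bn eps_ij eps_ji _ y) => m l.
- have [phi Fphi _] := emb m.
  by rewrite /y Fphi fmorph_eq0; exact: coord_neq0.
have [phi Fphi _] := emb m.
rewrite {1}/y pullA_iterS Fphi mutA_morph; apply: eq_mutA_at => l'.
exact/esym/Fphi.
Qed.

End Triviality.

Lemma eps_skewE (I : finType) (s : seed I) k l :
  eps s k l * (mult s k)%:R = - (eps s l k * (mult s l)%:R).
Proof.
have /and4P[_ /forallP d _ /forallP/(_ k)/forallP/(_ l)/eqP] := seedP s.
have nzd m : (mult s m)%:R != 0 :> rat by rewrite pnatr_eq0 -lt0n.
rewrite /eps_hat => /(canRL (divfK (nzd l))) ->.
by field.
Qed.

Lemma mult_gt0 (I : finType) (s : seed I) k : (0 < mult s k)%N.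
Proof. by have /and4P[_ /forallP -> _ _] := seedP s. Qed.

Theorem proposition1p8 (K : fieldType) (charK : [pchar K] =i pred0)
  (I : finType) (s : seed I) (i j : I)
  (hi : i \notin frozen s) (hj : j \notin frozen s) (neq_ij : i != j)
  (p h : nat)
  (ph : (p, h) \in [:: (0, 2); (1, 3); (2, 4); (3, 6)]%N)
  (eps_ij : eps s i j = - p%:R * eps s j i)
  (eps_ji : - p%:R * eps s j i = - p%:R) :
  trivial_transf K (sigma_mu_iter (h + 2) hi hj).
Proof.
(* For [p = 0] both weights vanish. *)
pose b m : nat := if odd m then nat_of_bool (0 < p)%N else p.
have bn : rank2_exchange b (h + 2).
  split=> [m|]; first by rewrite /b /= negbK.
  by move: ph; rewrite /b !inE => /or4P[] /eqP[-> ->].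
have eij : eps s i j = - (b 0%N)%:R by rewrite eps_ij.
have skew := eps_skewE s i j.
have nzd k : (mult s k)%:R != 0 :> rat by rewrite pnatr_eq0 -lt0n mult_gt0.
have eji : eps s j i = (b 1%N)%:R.
  rewrite /b /=; move: eps_ji skew; rewrite eij /b /=.
  case: p {ph eps_ij b bn eij} => [|p'] pe.
    rewrite oppr0 mul0r => /eqP; rewrite eq_sym oppr_eq0 mulf_eq0.
    by rewrite (negPf (nzd j)) orbF => /eqP.
  move=> _; have nzp : - p'.+1%:R != 0 :> rat by rewrite oppr_eq0 pnatr_eq0.
  by apply: (mulfI nzp); rewrite mulr1.
have multP l : mult s ((tperm i j ^+ (h + 2))%g l) = mult s l.
  have even_case m : ~~ odd m -> (tperm i j ^+ m)%g = 1%g.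
    move=> em; rewrite -[m]odd_double_half (negPf em) add0n -muln2 mulnC expgM.
    by rewrite expgS expg1 tperm2 expg1n.
  (* Only [h = 3] leaves the labels exchanged, and then the multipliers of [i]
     and [j] agree by skew-symmetry. *)
  case: (boolP (odd (h + 2))) => [oh|eh]; last by rewrite even_case // perm1.
  have p1 : p = 1%N.
    by move: ph oh; rewrite !inE => /or4P[] /eqP[-> ->].
  have mij : mult s i = mult s j.
    move: skew; rewrite eij eji /b p1 /= !mulNr !mul1r => /oppr_inj/eqP.
    by rewrite eqr_nat => /eqP.
  rewrite -[(h + 2)%N]prednK ?addn2 // expgS even_case; last first.
    by move: oh; rewrite addn2 /=.
  by rewrite mulg1; case: tpermP => // ->.
split.
- exact: (orbit_return neq_ij hi hj bn eij eji multP).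
- exact: (pullA_iter_id charK hi hj neq_ij bn eij eji).
- exact: (pullX_iter_id charK hi hj neq_ij bn eij eji).
Qed.
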